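(* Let $X, X_1,X_2,\dots$ be i.i.d. nonnegative real random variables with distribution function $F$ and right endpoint $x^*>0$ (possibly $x^*=\infty$). Suppose that $\mathsf{E}[X]=\int_0^\infty x\,dF(x)<\infty$ and that $F\in\mathsf{MDA}(G_\xi)$ with $\xi<1$. Then the following statements are true. (i) If $0\le\xi<1$ and $x^*=\infty$, then $$\mathsf{E}[R_n(x)]=L(n)\,n^\xi,\qquad x>0,$$ for some $L\in\mathcal{R}_0$. (ii) If $\xi\le0$ and $x^*<\infty$, then $$\mathsf{E}[R_n(x)]=\frac{x^*-x}{x}-\frac{x^*}{x}L(n)\,n^\xi,\qquad 0<x<x^*,$$ $$\mathsf{E}[\Delta_n(x)]=L(n)\,n^\xi,\qquad 0<x<x^*,$$ for some $L\in\mathcal{R}_0$.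
   Context: Notation. $\mathbb{N}=\{1,2,\dots\}$, $\mathbb{R}_+=[0,\infty)$, $(y)_+=\max(y,0)$. $F(x)=\mathsf{P}(X\le x)$ and $x^*=\sup\{x\in\mathbb{R}_+:F(x)<1\}$, assumed positive. $Z_n=\max(X_1,\dots,X_n)$. For $0<x<x^*$ and $n\in\mathbb{N}$, $$R_n(x)=\frac{(Z_n-x)_+}{x},\qquad \Delta_n(x)=\frac{x^*-\max(Z_n,x)}{x^*},$$ the latter being considered only when $x^*<\infty$. $G_\xi(z)=\exp\{-(1+\xi z)_+^{-1/\xi}\}$, $z\in\mathbb{R}$, is the standard generalized extreme value distribution, with $(1+\xi z)_+^{-1/\xi}$ interpreted as $e^{-z}$ if $\xi=0$ (and $\exp\{-(+\infty)\}=0$). $F\in\mathsf{MDA}(G)$, for a non-degenerate distribution $G$, means that there exist constants $a_n>0$, $b_n\in\mathbb{R}$ ($n\in\mathbb{N}$) such that $\lim_{n\to\infty}\mathsf{P}((Z_n-b_n)/a_n\le z)=\lim_{n\to\infty}[F(a_nz+b_n)]^n=G(z)$ for every continuity point $z$ of $G$. $\mathcal{R}_0$ is the set of slowly varying functions: eventually positive measurable functions $L$ on $\mathbb{R}_+$ with $\lim_{t\to\infty}L(ct)/L(t)=1$ for all $c>0$. *)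

(* Defs.v *)
From HB Require Import structures.
From mathcomp Require Import all_boot all_order all_algebra.
From mathcomp Require Import all_classical all_reals all_analysis.
Set Implicit Arguments.
Unset Strict Implicit.
Unset Printing Implicit Defensive.
Import Order.TTheory GRing.Theory Num.Theory.
Import numFieldNormedType.Exports.
Local Open Scope classical_set_scope.
Local Open Scope ring_scope.

Definition mutually_independent (d : measure_display) (T : measurableType d)
    (R : realType) (P : probability T R) (X : nat -> {RV P >-> R}) : Prop :=
  forall (J : seq nat) (A : nat -> set R),
    uniq J -> (forall i, measurable (A i)) ->
    P (\bigcap_(i in [set` J]) (X i @^-1` A i)) =
    (\prod_(i <- J) P (X i @^-1` A i))%E.

Definition identically_distributed (d : measure_display) (T : measurableType d)
    (R : realType) (P : probability T R) (X : nat -> {RV P >-> R}) : Prop :=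
  forall (i j : nat) (A : set R), measurable A ->
    distribution P (X i) A = distribution P (X j) A.

Definition iid (d : measure_display) (T : measurableType d)
    (R : realType) (P : probability T R) (X : nat -> {RV P >-> R}) : Prop :=
  mutually_independent X /\ identically_distributed X.

Definition distr_fun (d : measure_display) (T : measurableType d)
    (R : realType) (P : probability T R) (X : {RV P >-> R}) (x : R) : R :=
  fine (cdf X x).

(* The supremum is taken over nonnegative x only, so it is -oo when there is
   no such x with F x < 1. *)
Definition right_endpoint (R : realType) (F : R -> R) : \bar R :=
  ereal_sup [set x%:E | x in [set x : R | 0 <= x /\ F x < 1]].

(* The sample is X 1, X 2, ...; X 0 is the generic copy and does not enter the
   maximum.  For 0 < n the default value X 1 is itself one of the terms. *)
Definition sample_max (T : Type) (R : realType) (X : nat -> T -> R)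
    (n : nat) (w : T) : R :=
  \big[Num.max/X 1%N w]_(1 <= i < n.+1) X i w.

Definition rel_excess (T : Type) (R : realType) (X : nat -> T -> R)
    (n : nat) (x : R) (w : T) : R :=
  Num.max (sample_max X n w - x) 0 / x.

Definition rel_gap (T : Type) (R : realType) (X : nat -> T -> R)
    (xstar : R) (n : nat) (x : R) (w : T) : R :=
  (xstar - Num.max (sample_max X n w) x) / xstar.

(* powR sends 0 to 0 for every nonzero exponent, whereas here
   0 `^ (- xi^-1) = +oo when 0 < xi, so that G_xi = exp (- +oo) = 0 there. *)
Definition gev (R : realType) (xi z : R) : R :=
  if xi == 0 then expR (- expR (- z))
  else if (0 < xi) && (1 + xi * z <= 0) then 0
  else expR (- (Num.max (1 + xi * z) 0 `^ (- xi^-1))).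

Definition in_MDA (R : realType) (F G : R -> R) : Prop :=
  exists a b : nat -> R,
    (forall n : nat, (0 < n)%N -> 0 < a n) /\
    (forall z : R, {for z, continuous G} ->
       F (a n * z + b n) ^+ n @[n --> \oo] --> G z).

Definition slowly_varying (R : realType) (L : R -> R) : Prop :=
  [/\ measurable_fun (`[0, +oo[%classic : set R) L,
      \forall t \near +oo, 0 < L t &
      forall c : R, 0 < c -> L (c * t) / L t @[t --> +oo] --> (1 : R)].

(* Main.v *)
Require Import Defs.
From HB Require Import structures.
From mathcomp Require Import all_boot all_order all_algebra.
From mathcomp Require Import all_classical all_reals all_analysis.
From mathcomp Require Import measurable_realfun ring lra.
Set Implicit Arguments.
Unset Strict Implicit.
Unset Printing Implicit Defensive.
Import Order.TTheory GRing.Theory Num.Theory.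
Import numFieldNormedType.Exports.
Local Open Scope classical_set_scope.
Local Open Scope ring_scope.

(** Write [Z n] for the maximum of [n] independent copies and [K] for the distribution
    function of the excess of one copy over [x]. By independence and the layer-cake
    formula the excess of [Z n] over [x] has mean [H n], where
    [H t] is the integral of [1 - K r `^ t] over the positive half-line, and the two
    expectations of the theorem are affine functions of it. If the right endpoint is
    infinite then [H] tends to infinity; if it is [xs] then [H] increases to
    [xs - x]. So the theorem says that [H], respectively [xs - x - H], is regularly
    varying with index [xi]; the slowly varying factor is what remains after division
    by [t `^ xi].

    Both cases follow from the regular variation of the increments
    [H (2 * t) - H t], since [H] and [xs - x - H] are, up to bounded times, sums of
    increments over successive doublings ([ratio_from_increments_pinfty],
    [ratio_from_increments_lim]). An increment is the integral of
    [K y `^ t * (1 - K y `^ t)], an integrand concentrated where [K y `^ t] is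
    neither close to 0 nor close to 1. In the rescaled argument [y = A t * z + B t]
    given by the domain of attraction, [K y `^ t] converges to [gev xi z], so by
    dominated convergence the increment is asymptotic to [A t] times a positive
    constant ([cvg_increment]). The scale [A] is regularly varying with index [xi] by
    convergence of types ([cvg_types_scale]).

    The dominating function rests on the recursion between the times [t] and
    [2 * t]. On the right, the rescaled tail [t * (1 - K y)] at [z] is half of the
    one for time [2 * t] at an argument not much below [2 `^ (- xi) * z], and
    [2 `^ (- xi)] exceeds 1/2 as [xi < 1]; hence it decays like a power with exponent
    below [-1] ([right_tail_bound]). On the left, doubling the time squares
    [K y `^ t] while the argument changes by a bounded factor, which gives quadratic
    decay ([left_tail_bound]).

    Time is a real parameter throughout, and the points of the support of [gev xi]
    are written as quantiles at Gumbel levels; in these coordinates max-stability is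
    the translation rule [gev_quantileD] and the sign of [xi] hardly matters. *)

(** * Limits and real powers *)

Section limits.
Context {R : realType} {T : Type} {F : set_system T} {FF : Filter F}.
Implicit Types (f g : T -> R) (l e : R).

Lemma cvg_expR_comp f l : f x @[x --> F] --> l -> expR (f x) @[x --> F] --> expR l.
Proof. by move=> fl; apply: continuous_cvg fl; exact: continuous_expR. Qed.

Lemma cvg_ln_comp f l : 0 < l -> f x @[x --> F] --> l -> ln (f x) @[x --> F] --> ln l.
Proof. by move=> l0 fl; apply: continuous_cvg fl; exact: continuous_ln. Qed.

Lemma cvg_powR_comp f g l e : 0 < l -> f x @[x --> F] --> l -> g x @[x --> F] --> e ->
  f x `^ g x @[x --> F] --> l `^ e.
Proof.
move=> l0 fl ge; rewrite /(l `^ e) gt_eqF//.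
have : expR (g x * ln (f x)) @[x --> F] --> expR (e * ln l).
  by apply: cvg_expR_comp; apply: cvgM => //; exact: cvg_ln_comp.
apply: cvg_trans; apply: near_eq_cvg; near=> x; rewrite /powR gt_eqF//.
by near: x; exact: (cvgr_gt _ fl).
Unshelve. all: by end_near. Qed.

End limits.

Section powers.
Context {R : realType}.
Implicit Types y t : R.

Lemma powR_le1 y t : 0 <= y <= 1 -> 0 <= t -> y `^ t <= 1.
Proof.
move=> /andP[y0 y1] t0; rewrite [leRHS](_ : 1 = 1 `^ t); last by rewrite powR1.
by apply: ge0_ler_powR; rewrite ?nnegrE.
Qed.

Lemma cvg_powR_pinfty0 (y : R) : 0 <= y -> y < 1 -> y `^ t @[t --> +oo] --> (0 : R).
Proof.
rewrite le_eqVlt => /predU1P[<- _|y0 y1].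
  apply: (@cvg_trans _ (cst 0 t @[t --> (+oo : set_system R)])); last exact: cvg_cst.
  apply: near_eq_cvg; near=> t => /=.
  by rewrite powR0// gt_eqF//; near: t; exact: nbhs_pinfty_gt.
have -> : (fun t => y `^ t) = (fun t => expR (- t)) \o (fun t => - ln y * t).
  by apply/funext => t /=; rewrite /powR gt_eqF// mulNr opprK mulrC.
apply: cvg_comp; last exact: cvgr_expR.
by apply: gt0_cvgMry; [rewrite oppr_gt0 ln_lt0// y0 y1|exact: cvg_id].
Unshelve. all: by end_near. Qed.

Lemma mul_onem_le_powR (y t c : R) : 0 <= y -> 0 < t -> 0 < c -> c <= y `^ t ->
  t * (1 - y) <= - ln c.
Proof.
move=> y0 t0 c0 cyt.
have yt0 : 0 < y `^ t by exact: lt_le_trans cyt.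
have {}y0 : 0 < y by exact: gt0_powR yt0.
have : ln c <= t * ln y by rewrite -ln_powR ler_ln.
have : 1 + ln y <= y by rewrite -[leRHS]lnK ?posrE// expR_ge1Dx.
by rewrite addrC -lerBrDr -(ler_pM2l t0); lra.
Qed.

Lemma exists_exp2_bound (s t : R) : 0 < s -> exists k, t <= 2 ^+ k * s.
Proof.
move=> s0; exists (Num.truncn `|t / s|).+1; rewrite -ler_pdivrMr//.
have /andP[_ /ltW/(le_trans (ler_norm _))/le_trans] := truncn_itv (normr_ge0 (t / s)).
by apply; rewrite -natrX ler_nat ltnW// ltn_expl.
Qed.

(** Bernoulli's inequality for the next integer exponent. *)
Lemma onem_powR_le (y t : R) : 0 <= y <= 1 -> 0 < t -> 1 - y `^ t <= (t + 1) * (1 - y).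
Proof.
move=> /andP[y0 y1] t0.
have bernoulli n : 1 - n%:R * (1 - y) <= y ^+ n.
  elim: n => [|n IH]; first by rewrite mul0r subr0 expr0.
  rewrite exprS; apply: (@le_trans _ _ (y * (1 - n%:R * (1 - y)))); last first.
    by rewrite ler_wpM2l.
  rewrite -natr1; have n0 : 0 <= n%:R :> R by [].
  have : 0 <= n%:R * (1 - y) ^+ 2 :> R by rewrite mulr_ge0// sqr_ge0.
  nra.
have /andP[tn nt] := truncn_itv (ltW t0).
have yn : y ^+ (Num.truncn t).+1 <= y `^ t.
  have [->|yn0] := eqVneq y 0; first by rewrite expr0n powR0 ?gt_eqF.
  have {}y0 : 0 < y by rewrite lt_neqAle eq_sym yn0.
  by rewrite -powR_mulrn ?(ltW y0)// ger_powR ?y0// ltW.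
have := bernoulli (Num.truncn t).+1.
rewrite -natr1 => bn.
have : (Num.truncn t)%:R * (1 - y) <= t * (1 - y) by rewrite ler_wpM2r// subr_ge0.
lra.
Qed.

End powers.

(** * Gumbel coordinates on the extreme value distributions *)

(** The Gumbel distribution function, that is [gev 0]. *)
Definition gumbel (R : realType) (u : R) : R := expR (- expR (- u)).

(** The quantile function of [gev xi] read at the level [gumbel u]: with the
    argument ranging over the whole line the three types of extreme value
    distributions need no case distinction on their supports. *)
Definition gev_quantile (R : realType) (xi u : R) : R :=
  if xi == 0 then u else (expR (xi * u) - 1) / xi.

Section gev_quantile.
Context {R : realType}.
Implicit Types xi u v z : R.

Lemma gev_quantile0 xi : gev_quantile xi 0 = 0.
Proof.
by rewrite /gev_quantile; case: ifP => // _; rewrite mulr0 expR0 subrr mul0r.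
Qed.

(** Translations in Gumbel coordinates act as affine maps; this is the
    max-stability of [gev xi]. *)
Lemma gev_quantileD xi u v :
  gev_quantile xi (u + v) = expR (xi * v) * gev_quantile xi u + gev_quantile xi v.
Proof.
rewrite /gev_quantile; case: ifPn => [/eqP ->|xi0].
  by rewrite mul0r expR0 mul1r.
by rewrite mulrDr expRD; field.
Qed.

Lemma gev_quantile_lt xi : {homo gev_quantile xi : u v / u < v}.
Proof.
move=> u v uv; rewrite /gev_quantile; case: ifPn => // xi0.
have [xi_lt0|xi_gt0|xiz] := ltgtP xi 0; last by rewrite xiz eqxx in xi0.
- rewrite ltr_nM2r ?invr_lt0// -subr_gt0 opprB addrA subrK subr_gt0.
  by rewrite ltr_expR ltr_nM2l.
- rewrite ltr_pM2r ?invr_gt0// -subr_gt0 opprB addrA subrK subr_gt0.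
  by rewrite ltr_expR ltr_pM2l.
Qed.

Lemma continuous_gev_quantile xi : continuous (gev_quantile xi).
Proof.
have [->|xi0] := eqVneq xi 0.
  have -> : gev_quantile (0 : R) = @id R.
    by apply/funext => u; rewrite /gev_quantile eqxx.
  by move=> u; exact: cvg_id.
have -> : gev_quantile xi = fun u => (expR (xi * u) - 1) / xi.
  by apply/funext => u; rewrite /gev_quantile (negbTE xi0).
move=> u; apply: cvgM; last exact: cvg_cst.
apply: cvgB; last exact: cvg_cst.
apply: continuous_comp; last exact: continuous_expR.
by apply: cvgM; [exact: cvg_cst|exact: cvg_id].
Qed.

Lemma scale_gev_quantile_gt0 xi u : 0 < 1 + xi * gev_quantile xi u.
Proof.
rewrite /gev_quantile; case: ifPn => [/eqP ->|xi0].
  by rewrite mul0r addr0.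
rewrite mulrC divfK// addrC subrK; exact: expR_gt0.
Qed.

Lemma gev_in_support xi z : xi != 0 -> 0 < 1 + xi * z ->
  gev xi z = expR (- expR (- xi^-1 * ln (1 + xi * z))).
Proof.
move=> xi0 z0; rewrite /gev (negbTE xi0) leNgt z0 andbF.
by rewrite (max_idPl (ltW z0)) /powR gt_eqF.
Qed.

Lemma gev_quantileK xi u : gev xi (gev_quantile xi u) = gumbel u.
Proof.
have [->|xi0] := eqVneq xi 0; first by rewrite /gev /gev_quantile eqxx.
rewrite gev_in_support// ?scale_gev_quantile_gt0// /gev_quantile (negbTE xi0).
rewrite [xi * _]mulrC divfK// [1 + _]addrC subrK expRK /gumbel.
by congr (expR (- expR _)); rewrite mulNr mulrA mulVf// mul1r.
Qed.

Lemma continuous_gev_at_quantile xi u :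
  {for gev_quantile xi u, continuous (gev xi)}.
Proof.
have [->|xi0] := eqVneq xi 0.
  have -> : gev (0 : R) = fun z : R => expR (- expR (- z)).
    by apply/funext => z; rewrite /gev eqxx.
  rewrite /continuous_at.
  apply: continuous_comp; last exact: continuous_expR.
  apply: cvgN; apply: continuous_comp; last exact: continuous_expR.
  by apply: cvgN; exact: cvg_id.
have q0 := scale_gev_quantile_gt0 xi u.
have cz (z : R) : (fun y => 1 + xi * y) y @[y --> z] --> 1 + xi * z.
  apply: cvgD; first exact: cvg_cst.
  by apply: cvgM; [exact: cvg_cst|exact: cvg_id].
suff : gev xi z @[z --> gev_quantile xi u] --> gev xi (gev_quantile xi u) by [].
rewrite [X in _ --> X]gev_in_support//.
have : expR (- expR (- xi^-1 * ln (1 + xi * z))) @[z --> gev_quantile xi u] -->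
    expR (- expR (- xi^-1 * ln (1 + xi * gev_quantile xi u))).
  apply: cvg_expR_comp; apply: cvgN; apply: cvg_expR_comp.
  by apply: cvgM; [exact: cvg_cst|apply: cvg_ln_comp => //; exact: cz].
apply: cvg_trans; apply: near_eq_cvg; near=> z; rewrite gev_in_support//.
by near: z; exact: (cvgr_gt _ (cz _)).
Unshelve. all: by end_near. Qed.

(** Outside the range of the quantile function the support of [gev xi] has been
    left on one side, and [gev xi] is constant there. *)
Lemma gev_quantile_range xi z :
  [\/ exists u, z = gev_quantile xi u,
      (forall u, z <= gev_quantile xi u) /\ gev xi z = 0 |
      (forall u, gev_quantile xi u <= z) /\ gev xi z = 1].
Proof.
have [->|xi0] := eqVneq xi 0.
  by apply: Or31; exists z; rewrite /gev_quantile eqxx.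
have [z0|z0] := ltP 0 (1 + xi * z).
  apply: Or31; exists (xi^-1 * ln (1 + xi * z)); rewrite /gev_quantile (negbTE xi0).
  rewrite mulrA divff// mul1r lnK ?posrE//; field.
  exact: xi0.
have lezq u : xi * z <= xi * gev_quantile xi u.
  by rewrite -(lerD2l 1) (le_trans z0)// ltW// scale_gev_quantile_gt0.
have [xi_lt0|xi_gt0|xiz] := ltgtP xi 0; last by rewrite xiz eqxx in xi0.
- apply: Or33; split=> [u|]; first by have := lezq u; rewrite ler_nM2l.
  rewrite /gev (negbTE xi0) ltNge (ltW xi_lt0)/= (max_idPr z0) powR0.
    by rewrite oppr0 expR0.
  by rewrite oppr_eq0 invr_eq0.
- apply: Or32; split=> [u|]; first by have := lezq u; rewrite ler_pM2l.
  by rewrite /gev (negbTE xi0) xi_gt0 z0.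
Qed.

Lemma gumbel_gt0 u : 0 < gumbel u.
Proof. exact: expR_gt0. Qed.

Lemma gumbel_lt1 u : gumbel u < 1.
Proof. by rewrite -expR0 ltr_expR oppr_lt0 expR_gt0. Qed.

Lemma gumbel_lt : {homo @gumbel R : u v / u < v}.
Proof. by move=> u v uv; rewrite ltr_expR ltrN2 ltr_expR ltrN2. Qed.

(** Max-stability: powers of the Gumbel distribution are translations. *)
Lemma gumbel_powR u k : 0 < k -> gumbel u `^ k^-1 = gumbel (u + ln k).
Proof.
move=> k0; rewrite /powR gt_eqF ?gumbel_gt0// expRK.
by rewrite /gumbel opprD expRD (expRN (ln k)) lnK// mulrN mulrC.
Qed.

Lemma gumbel_small (e : R) : 0 < e -> exists u, gumbel u < e.
Proof.
move=> e0; exists (- ln (Num.max 1 (1 - ln e))).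
rewrite /gumbel opprK lnK ?posrE ?lt_max ?ltr01// -[ltRHS]lnK// ltr_expR.
by rewrite ltrNl lt_max; apply/orP; right; lra.
Qed.

Lemma gumbel_large (e : R) : 0 < e -> exists u, 1 - e < gumbel u.
Proof.
move=> e0; exists (- ln (e / 2)).
apply: (lt_le_trans _ (expR_ge1Dx _)).
by rewrite opprK lnK ?posrE; lra.
Qed.

End gev_quantile.

(** * Normalisation along a real parameter *)

(** Attraction to [gev xi] with powers, norming scale and norming shift indexed by
    a real time, so that time can be multiplied by any positive number; the limits
    are only required where [gev xi] is strictly between 0 and 1. *)
Definition attracted (R : realType) (xi : R) (K A B : R -> R) : Prop :=
  forall u : R, K (A t * gev_quantile xi u + B t) `^ t @[t --> +oo] --> gumbel u.

Section real_normalisation.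
Context {R : realType}.
Implicit Types (K A B : R -> R) (xi t u : R).

Lemma cvg_truncnS : (Num.truncn t).+1 @[t --> (+oo : set_system R)] --> \oo.
Proof.
apply/cvgnyPge => n; near=> t.
apply: leqW; rewrite truncn_ge_nat; last by near: t; exact: nbhs_pinfty_ge.
by near: t; exact: nbhs_pinfty_ge.
Unshelve. all: by end_near. Qed.

Lemma cvg_inv_pinfty : t^-1 @[t --> (+oo : set_system R)] --> (0 : R).
Proof.
apply/gtr0_cvgV0; last exact: cvg_id.
exact: nbhs_pinfty_gt.
Qed.

Lemma cvg_div_truncnS :
  t / (Num.truncn t).+1%:R @[t --> (+oo : set_system R)] --> (1 : R).
Proof.
apply: (@squeeze_cvgr _ _ _ _ (fun t => 1 - t^-1) (fun=> 1)); last exact: cvg_cst.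
  near=> t.
  have t0 : 0 < t by near: t; exact: nbhs_pinfty_gt.
  have /andP[nt tn] := truncn_itv (ltW t0).
  have n0 : 0 < (Num.truncn t).+1%:R :> R by rewrite ltr0n.
  rewrite ler_pdivlMr// ler_pdivrMr// mul1r (ltW tn) andbT.
  have -> : (Num.truncn t).+1%:R = (Num.truncn t)%:R + 1 :> R by rewrite natr1.
  rewrite -(ler_pM2l t0) mulrA mulrBr divff ?gt_eqF// mulr1.
  by set m : R := (Num.truncn t)%:R; nra.
rewrite -[X in _ --> X]subr0; apply: cvgB; first exact: cvg_cst.
exact: cvg_inv_pinfty.
Unshelve. all: by end_near. Qed.

(** Norming constants taken at the integer next to [t] also norm the powers of
    exponent [t], as the two exponents are asymptotically equivalent. Over a bounded
    range of times they take finitely many values, whence the bound. *)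
Lemma in_MDA_attracted xi (F : R -> R) : (forall y, 0 <= F y) ->
  in_MDA F (gev xi) -> exists A B, [/\ (forall t, 0 < A t),
    (forall x M, exists C, forall t, t <= M -> `|B t - x| / A t <= C) &
    attracted xi F A B].
Proof.
move=> F0 [a [b [a0 ab]]].
exists (fun t => a (Num.truncn t).+1), (fun t => b (Num.truncn t).+1); split.
- by move=> t; exact: a0.
- move=> x M; exists (\sum_(i < (Num.truncn M).+1) `|b i.+1 - x| / a i.+1) => t tM.
  have tM1 : (Num.truncn t < (Num.truncn M).+1)%N by rewrite ltnS le_truncn.
  rewrite (bigD1 (Ordinal tM1))//= lerDl sumr_ge0// => i _.
  by rewrite divr_ge0// ltW// a0.
- move=> u.
  have /(ab _) := @continuous_gev_at_quantile _ xi u.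
  rewrite gev_quantileK => Fu.
  have {Fu} := cvg_comp _ _ cvg_truncnS Fu.
  move=> /(cvg_powR_comp (gumbel_gt0 u)) /(_ cvg_div_truncnS).
  rewrite powRr1 ?ltW ?gumbel_gt0//.
  apply: cvg_trans; apply: near_eq_cvg; near=> t => /=.
  by rewrite -powR_mulrn// -powRrM [_%:R * _]mulrC divfK// pnatr_eq0.
Unshelve. all: by end_near. Qed.

(** On the left of a point where [F] is below 1 its powers tend to 0, so the points at
    which [F] is evaluated eventually leave that region, where [F] may therefore be
    replaced by 0. *)
Lemma attracted_shift xi (F A B : R -> R) x : {homo F : y z / y <= z} ->
    (forall y, 0 <= F y) -> F x < 1 -> attracted xi F A B ->
  attracted xi (fun r => if r < 0 then 0 else F (x + r)) A (fun t => B t - x).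
Proof.
move=> Fnd F0 Fx1 FA u; have := FA u; apply: cvg_trans; apply: near_eq_cvg.
have Fxt := cvg_powR_pinfty0 (F0 x) Fx1.
near=> t.
have t0 : 0 < t by near: t; exact: nbhs_pinfty_gt.
case: ifPn => [yx|_]; last by congr (F _ `^ _); ring.
suff : F x `^ t < F x `^ t by rewrite ltxx.
have : F x `^ t < F (A t * gev_quantile xi u + B t) `^ t.
  apply: (@lt_trans _ _ (gumbel u / 2)).
    near: t; apply: (cvgr_lt _ Fxt); have := gumbel_gt0 u; lra.
  near: t; apply: (cvgr_gt _ (FA u)); have := gumbel_gt0 u; lra.
move=> /lt_le_trans; apply.
by rewrite ge0_ler_powR ?nnegrE ?F0 ?(ltW t0)// Fnd//; lra.
Unshelve. all: by end_near. Qed.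

Section types.
Context {K A B : R -> R} {xi : R}.
Hypothesis K_nd : {homo K : y z / y <= z}.
Hypothesis K_ge0 : forall y, 0 <= K y.
Hypothesis A_gt0 : forall t, 0 < A t.
Hypothesis KA : attracted xi K A B.

Lemma cvg_scale_pinfty (k : R) : 0 < k -> k * t @[t --> +oo] --> +oo.
Proof. by move=> k0; apply: gt0_cvgMry => //; exact: cvg_id. Qed.

(** The [t]-th powers of [K] at the two sides tend to [gumbel (u + ln k)] and
    [gumbel v], which are ordered strictly; monotonicity of [K] carries the order
    back to the arguments. *)
Lemma near_affine_lt (k u v : R) : 0 < k -> u + ln k < v ->
  \forall t \near +oo, A (k * t) * gev_quantile xi u + B (k * t)
                       < A t * gev_quantile xi v + B t.
Proof.
move=> k0 uv.
have Ku : K (A (k * t) * gev_quantile xi u + B (k * t)) `^ t @[t --> +oo]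
    --> gumbel (u + ln k).
  rewrite -gumbel_powR//.
  have := cvg_comp _ _ (cvg_scale_pinfty k0) (@KA u).
  move=> /(cvg_powR_comp (gumbel_gt0 u)) /(_ (cvg_cst k^-1)).
  apply: cvg_trans; apply: near_eq_cvg; near=> t => /=.
  by rewrite -powRrM [k * t]mulrC mulfK ?gt_eqF.
have uv' := gumbel_lt uv; near=> t.
have t0 : 0 < t by near: t; exact: nbhs_pinfty_gt.
rewrite ltNge; apply/negP => /K_nd Kuv.
have : K (A (k * t) * gev_quantile xi u + B (k * t)) `^ t <
       K (A t * gev_quantile xi v + B t) `^ t.
  apply: (@lt_trans _ _ ((gumbel (u + ln k) + gumbel v) / 2)).
    by near: t; apply: (cvgr_lt _ Ku); lra.
  by near: t; apply: (cvgr_gt _ (@KA v)); lra.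
by rewrite ltNge ge0_ler_powR ?nnegrE ?(ltW t0).
Unshelve. all: by end_near. Qed.

Lemma near_affine_gt (k u v : R) : 0 < k -> v < u + ln k ->
  \forall t \near +oo, A t * gev_quantile xi v + B t
                       < A (k * t) * gev_quantile xi u + B (k * t).
Proof.
move=> k0 uv.
have k'0 : 0 < k^-1 by rewrite invr_gt0.
have := @near_affine_lt k^-1 v u k'0; rewrite lnV ?posrE// ltrBlDr => /(_ uv).
move=> /(cvg_scale_pinfty k0) vu; near=> t.
suff : A (k^-1 * (k * t)) * gev_quantile xi v + B (k^-1 * (k * t))
    < A (k * t) * gev_quantile xi u + B (k * t) by rewrite mulKf ?gt_eqF.
by near: t.
Unshelve. all: by end_near. Qed.

(** Convergence of types: the norming at time [k * t], seen from the norming at time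
    [t], converges, since it is squeezed between quantiles close to the limit. *)
Lemma cvg_types (k u : R) : 0 < k ->
  (A (k * t) * gev_quantile xi u + B (k * t) - B t) / A t @[t --> +oo]
    --> gev_quantile xi (u + ln k).
Proof.
move=> k0; apply/cvgrPdist_lt => e e0.
have /cvgrPdist_lt /(_ _ e0) := @continuous_gev_quantile _ xi (u + ln k).
move=> /nbhs_ballP[d /= d0 dq].
have qp : gev_quantile xi (u + ln k + d / 2) < gev_quantile xi (u + ln k) + e.
  have : `|gev_quantile xi (u + ln k) - gev_quantile xi (u + ln k + d / 2)| < e.
    by apply: dq; rewrite /ball/= opprD addNKr normrN gtr0_norm; lra.
  by rewrite ltr_norml => /andP[]; lra.
have qm : gev_quantile xi (u + ln k) - e < gev_quantile xi (u + ln k - d / 2).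
  have : `|gev_quantile xi (u + ln k) - gev_quantile xi (u + ln k - d / 2)| < e.
    by apply: dq; rewrite /ball/= opprB addrC subrK gtr0_norm; lra.
  by rewrite ltr_norml => /andP[]; lra.
near=> t.
have At : A t != 0 by rewrite gt_eqF.
rewrite ltr_distlC; apply/andP; split.
  apply: (lt_trans qm); rewrite ltr_pdivlMr// ltrBrDr mulrC.
  by near: t; apply: near_affine_gt => //; lra.
apply: (le_lt_trans _ qp); rewrite ler_pdivrMr// lerBlDr [_ * A t]mulrC ltW//.
by near: t; apply: near_affine_lt => //; lra.
Unshelve. all: by end_near. Qed.

Lemma cvg_types_shift (k : R) : 0 < k ->
  (B (k * t) - B t) / A t @[t --> +oo] --> gev_quantile xi (ln k).
Proof.
move=> k0; have := cvg_types (u := 0) k0; rewrite add0r; apply: cvg_trans.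
by apply: near_eq_cvg; near=> t; rewrite gev_quantile0 mulr0 add0r.
Unshelve. all: by end_near. Qed.

(** The scale is regularly varying; it is isolated by subtracting two instances of
    the convergence of types. *)
Lemma cvg_types_scale (k : R) : 0 < k ->
  A (k * t) / A t @[t --> +oo] --> k `^ xi.
Proof.
move=> k0.
have q1 : gev_quantile xi 1 != 0.
  by rewrite gt_eqF// -(gev_quantile0 xi) gev_quantile_lt.
pose q (u t : R) := (A (k * t) * gev_quantile xi u + B (k * t) - B t) / A t.
have : (q 1 t - (B (k * t) - B t) / A t) / gev_quantile xi 1 @[t --> +oo]
    --> (gev_quantile xi (1 + ln k) - gev_quantile xi (ln k)) / gev_quantile xi 1.
  apply: cvgM; last exact: cvg_cst.
  by apply: cvgB; [exact: cvg_types|exact: cvg_types_shift].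
rewrite gev_quantileD addrK mulfK// /powR gt_eqF//.
apply: cvg_trans; apply: near_eq_cvg; near=> t => /=.
by rewrite /q -mulrBl opprB addrA subrK addrK mulrAC mulfK.
Unshelve. all: by end_near. Qed.

(** Far out the linear terms decide the comparison of the two affine maps. The shift
    is left arbitrary so that both tails are covered, with shift [B] and [- B]. *)
Lemma near_affine_le (S : R -> R) (k l s : R) : 0 < k -> l < k `^ xi ->
    (S (k * t) - S t) / A t @[t --> +oo] --> s -> exists2 M : R, 0 < M &
  \forall t \near +oo, forall z : R, M <= z ->
    A t * (l * z) + S t <= A (k * t) * z + S (k * t).
Proof.
move=> k0 lk Ss; pose l' := (l + k `^ xi) / 2; pose b := `|s| + 1.
have ll' : 0 < l' - l by rewrite /l'; lra.
have b0 : 0 < b by rewrite /b ltr_wpDl.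
exists (b / (l' - l)); first exact: divr_gt0.
have Al : \forall t \near +oo, l' < A (k * t) / A t.
  by apply: (cvgr_gt _ (cvg_types_scale k0)); rewrite /l'; lra.
have Sb : \forall t \near +oo, - b < (S (k * t) - S t) / A t.
  apply: (cvgr_gt _ Ss); rewrite ltrNl.
  by rewrite (le_lt_trans (ler_norm _))// normrN /b ltrDl.
near=> t => z; rewrite ler_pdivrMr// => bz.
have : l' < A (k * t) / A t by near: t.
have : - b < (S (k * t) - S t) / A t by near: t.
have At := A_gt0 t; rewrite !ltr_pdivlMr// => St Alt.
have z0 : 0 < z by rewrite -(pmulr_lgt0 _ ll') (lt_le_trans b0).
have : l' * A t * z <= A (k * t) * z by rewrite ler_wpM2r// ltW.
have : b * A t <= z * (l' - l) * A t by rewrite ler_wpM2r// ltW.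
nra.
Unshelve. all: by end_near. Qed.

Lemma near_scale_right (k l : R) : 0 < k -> l < k `^ xi -> exists2 M : R, 0 < M &
  \forall t \near +oo, forall z : R, M <= z ->
    A t * (l * z) + B t <= A (k * t) * z + B (k * t).
Proof. by move=> k0 lk; exact: near_affine_le (cvg_types_shift k0). Qed.

Lemma near_scale_left (k l : R) : 0 < k -> l < k `^ xi -> exists2 M : R, 0 < M &
  \forall t \near +oo, forall w : R, M <= w ->
    B (k * t) - A (k * t) * w <= B t - A t * (l * w).
Proof.
move=> k0 lk.
have Bs : (- B (k * t) - - B t) / A t @[t --> +oo] --> - gev_quantile xi (ln k).
  have : - ((B (k * t) - B t) / A t) @[t --> +oo] --> - gev_quantile xi (ln k).
    by apply: cvgN; exact: cvg_types_shift.
  apply: cvg_trans; apply: near_eq_cvg; near=> t.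
  by rewrite -mulNr; congr (_ / _); ring.
have [M M0 HM] := near_affine_le (S := fun t => - B t) k0 lk Bs.
exists M => //; apply: filterS HM => t HM w /HM; lra.
Unshelve. all: by end_near. Qed.

End types.

End real_normalisation.

(** * Tail bounds uniform in time *)

Section tails.
Context {R : realType} {K A B : R -> R} {xi : R}.
Hypothesis K_nd : {homo K : y z / y <= z}.
Hypothesis K_ge0 : forall y : R, 0 <= K y.
Hypothesis K_le1 : forall y : R, K y <= 1.
Hypothesis A_gt0 : forall t, 0 < A t.
Hypothesis KA : attracted xi K A B.

(** At nonnegative arguments the rescaled tail is bounded: at argument 0 the power
    of [K] stays away from 0. *)
Let right_bound : exists2 C : R, 0 < C & \forall t \near +oo,
  forall z : R, 0 <= z -> t * (1 - K (A t * z + B t)) <= C.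
Proof.
have g0 := @gumbel_gt0 R 0.
exists (- ln (gumbel 0 / 2)).
  by rewrite oppr_gt0 ln_lt0// divr_gt0//=; have := @gumbel_lt1 R 0; lra.
near=> t => z z0.
have t0 : 0 < t by near: t; exact: nbhs_pinfty_gt.
apply: (@le_trans _ _ (t * (1 - K (B t)))).
  by rewrite ler_pM2l// lerD2l lerN2 K_nd// lerDr mulr_ge0// ltW.
apply: mul_onem_le_powR => //; first exact: divr_gt0.
have -> : B t = A t * gev_quantile xi 0 + B t by rewrite gev_quantile0 mulr0 add0r.
near: t; apply: (cvgr_ge _ (@KA 0)); lra.
Unshelve. all: by end_near. Qed.

(** Up to the factor 1/2, the rescaled tail at time [t] and argument [z] is the one
    at time [2 * t] and an argument that is, far out, at least [l * z], where [l] may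
    be any number below [2 `^ (- xi)]. As [xi < 1] there is such an [l] larger than
    1/2, and iterating turns boundedness into decay with the exponent [p] defined by
    [l `^ p = 2^-1], which is larger than 1. *)
Lemma right_tail_bound : xi < 1 -> exists p C M : R, [/\ 1 < p, p <= 2, 0 < C, 0 < M &
  \forall t \near +oo, forall z : R, M <= z ->
    t * (1 - K (A t * z + B t)) <= C * z `^ (- p)].
Proof.
move=> xi1.
(* any exponent larger than 1 with inverse larger than [xi] would do; at most 2 so
   that the bound of the left tail is of no larger order *)
pose p := 2 / (1 + Num.max xi 0).
have mx1 : Num.max xi 0 < 1 by rewrite gt_max xi1 ltr01.
have mx0 : 0 <= Num.max xi 0 by rewrite le_max lexx orbT.
have p0 : 0 < p by rewrite divr_gt0//; lra.
have pV : xi < p^-1.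
  have : xi <= Num.max xi 0 by rewrite le_max lexx.
  by rewrite /p invf_div; lra.
pose l : R := 2^-1 `^ p^-1.
have l0 : 0 < l by rewrite powR_gt0// invr_gt0.
have half1 : ln (2^-1 : R) < 0 by rewrite ln_lt0//; lra.
have l1 : l < 1.
  have pV0 : 0 < p^-1 by rewrite invr_gt0.
  by rewrite /l /powR gt_eqF// -[ltRHS]expR0 ltr_expR pmulr_rlt0.
have lp : l `^ p = 2^-1 by rewrite -powRrM mulVf ?gt_eqF// powRr1// invr_ge0.
have lxi : l < 2^-1 `^ xi by rewrite /l /powR gt_eqF// ltr_expR ltr_nM2r.
have half0 : (0 : R) < 2^-1 by rewrite invr_gt0.
have [M M0 [S [_ HS]]] := near_scale_right K_nd K_ge0 A_gt0 KA half0 lxi.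
have [C0 C00 [N [_ HN]]] := right_bound.
exists p, (C0 * M `^ p), M; split => //.
- by rewrite /p ltr_pdivlMr; lra.
- by rewrite /p ler_pdivrMr; lra.
- by rewrite mulr_gt0// powR_gt0.
have lM : l * M <= M by rewrite ger_pMl// ltW.
have lM0 : 0 < l * M by exact: mulr_gt0.
have base (t z : R) : N < t -> l * M <= z -> z <= M ->
    t * (1 - K (A t * z + B t)) <= C0 * M `^ p * z `^ (- p).
  move=> Nt lMz zM; have z0 : 0 < z by exact: lt_le_trans lMz.
  apply: (le_trans (HN _ Nt _ (ltW z0))).
  rewrite -mulrA ler_peMr ?(ltW C00)// powRN ler_pdivlMr ?powR_gt0// mul1r.
  by apply: ge0_ler_powR => //; rewrite ?nnegrE ltW.
have step k (t z : R) : Num.max N (Num.max S 1) < t -> l * M <= z -> l ^+ k * z <= M ->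
    t * (1 - K (A t * z + B t)) <= C0 * M `^ p * z `^ (- p).
  elim: k t z => [|k IH] t z; rewrite !gt_max => /and3P[Nt St t1] lMz kz.
    by rewrite mul1r in kz; exact: base.
  have [zM|/ltW Mz] := leP z M; first exact: base.
  have z0 : 0 < z by exact: lt_le_trans Mz.
  have /HS /(_ _ Mz) : S < 2 * t by lra.
  rewrite mulKf// => /K_nd Kle.
  have := IH (2 * t) (l * z).
  rewrite mulrA -exprSr !gt_max ler_pM2l// Mz kz => /(_ _ isT isT) {}IH.
  have {}IH : 2 * t * (1 - K (A (2 * t) * (l * z) + B (2 * t))) <=
      C0 * M `^ p * (l * z) `^ (- p).
    by apply: IH; apply/and3P; split; apply: lt_trans (_ : t < _) => //; lra.
  have E : C0 * M `^ p * (l * z) `^ (- p) = 2 * (C0 * M `^ p * z `^ (- p)).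
    by rewrite powRM ?ltW// (powRN l) lp invrK; ring.
  rewrite E in IH; nra.
near=> t => z Mz.
have [k _ kz] : exists2 k, True & l ^+ k * z <= M.
  have : l ^+ k * z @[k --> \oo] --> 0 * z.
    by apply: cvgM; [apply: cvg_expr; rewrite gtr0_norm|exact: cvg_cst].
  rewrite mul0r => /cvgr_le /(_ _ M0)[k _ /(_ k (leqnn k))] /= ?; by exists k.
apply: (step k) => //; last exact: le_trans Mz.
by near: t; apply: nbhs_pinfty_gt; exact: num_real.
Unshelve. all: by end_near. Qed.

Hypothesis K_lt0 : forall y : R, y < 0 -> K y = 0.
Hypothesis BA : forall M, exists C, forall t, t <= M -> `|B t| / A t <= C.

(** The power of [K] at time [t] and argument [- w] is at most the square of the one at
    time [t / 2] and argument [- (l * w)]. When the latter is at most [l ^+ 2],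
    squaring gains exactly the factor lost in [w ^- 2] by passing from [w] to [l * w].
    The recursion ends at bounded times, where [K] vanishes at all but boundedly many
    rescaled arguments. *)
Lemma left_tail_bound : exists C M : R, [/\ 0 < C, 0 < M &
  \forall t \near +oo, forall w : R, M <= w ->
    K (B t - A t * w) `^ t <= C * w ^- 2].
Proof.
have x2 : 0 < 2 `^ xi :> R by rewrite powR_gt0.
pose l := Num.min 2^-1 (2 `^ xi / 2).
have l0 : 0 < l by rewrite lt_min; apply/andP; split; lra.
have l1 : l < 1 by rewrite gt_min; apply/orP; left; lra.
have lxi : l < 2 `^ xi by rewrite gt_min; apply/orP; right; lra.
have [M M0 [S [_ HS]]] := near_scale_left K_nd K_ge0 A_gt0 KA (@ltr0Sn R 1) lxi.
have [u ul] : exists u : R, gumbel u < l ^+ 2 by apply: gumbel_small; rewrite exprn_gt0.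
have [S' [_ HS']] : \forall t \near +oo, forall w : R, `|gev_quantile xi u| <= w ->
    K (B t - A t * w) `^ t <= l ^+ 2.
  near=> t => w uw.
  have t0 : 0 < t by near: t; exact: nbhs_pinfty_gt.
  apply: (@le_trans _ _ (K (A t * gev_quantile xi u + B t) `^ t)); last first.
    by near: t; exact: (cvgr_le _ (@KA u)).
  rewrite ge0_ler_powR ?nnegrE ?(ltW t0)// K_nd// addrC lerD2r.
  rewrite -mulrN ler_pM2l// lerNl (le_trans _ uw)//.
  by rewrite (le_trans (ler_norm _))// normrN.
pose M1 := Num.max M (`|gev_quantile xi u| / l).
have M10 : 0 < M1 by rewrite lt_max M0.
have lM1 : `|gev_quantile xi u| <= l * M1.
  by rewrite mulrC -ler_pdivrMr// le_max lexx orbT.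
pose N := Num.max S (Num.max S' 0) + 1.
have [NS NS' N0] : [/\ S < N, S' < N & 0 < N].
  by rewrite /N; split; rewrite ltr_pwDr// !le_max lexx ?orbT.
have [C1 HC1] := BA (2 * N).
pose C : R := M1 ^+ 2 + C1 ^+ 2.
have C0 : 0 < C by rewrite ltr_pwDl ?exprn_gt0// sqr_ge0.
exists C, M1; split => //.
have Wle1 (t w : R) : 0 < t -> K (B t - A t * w) `^ t <= 1.
  by move=> t0; rewrite powR_le1 ?K_ge0 ?K_le1// ltW.
have small (t w : R) : 0 < t -> 0 < w -> w ^+ 2 <= C -> K (B t - A t * w) `^ t <= C * w ^- 2.
  move=> t0 w0 wC; apply: (le_trans (Wle1 _ _ t0)).
  by rewrite ler_pdivlMr ?exprn_gt0// mul1r.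
(* induction on the number of halvings that bring the time below [2 * N] *)
have main k (t w : R) : N <= t -> t <= 2 ^+ k * (2 * N) -> l * M1 <= w ->
    K (B t - A t * w) `^ t <= C * w ^- 2.
  elim: k t w => [|k IH] t w Nt tk lw.
    have t0 : 0 < t by exact: lt_le_trans Nt.
    have w0 : 0 < w by apply: lt_le_trans lw; exact: mulr_gt0.
    rewrite mul1r in tk.
    have [y0|y0] := ltP (B t - A t * w) 0.
      by rewrite K_lt0// powR0 ?gt_eqF// ltW// mulr_gt0// invr_gt0 exprn_gt0.
    apply: small => //; rewrite /C ler_wpDl ?sqr_ge0//.
    have wC : w <= C1.
      apply: le_trans (HC1 _ tk); rewrite ler_pdivlMr//.
      by rewrite (le_trans _ (ler_norm _))// mulrC -subr_ge0.
    by rewrite ler_sqr ?nnegrE ?(ltW w0)// (le_trans (ltW w0)).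
  have t0 : 0 < t by exact: lt_le_trans Nt.
  have w0 : 0 < w by apply: lt_le_trans lw; exact: mulr_gt0.
  have [t2|/ltW t2] := leP t (2 * N).
    by apply: IH => //; rewrite (le_trans t2)// ler_peMl ?exprn_ege1//; lra.
  have [wM|/ltW wM] := leP w M1.
    by apply: small => //; rewrite /C ler_wpDr ?sqr_ge0// ler_sqr ?nnegrE ?(ltW w0) ?(ltW M10).
  have /HS /(_ w) : S < t / 2 by lra.
  rewrite mulrC divfK// => /(_ _) Kle.
  have {}Kle : K (B t - A t * w) <= K (B (t / 2) - A (t / 2) * (l * w)).
    by apply: K_nd; apply: Kle; apply: le_trans wM; rewrite le_max lexx.
  have lw' : l * M1 <= l * w by rewrite ler_pM2l.
  have {}IH := IH (t / 2) (l * w).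
  have {}IH : K (B (t / 2) - A (t / 2) * (l * w)) `^ (t / 2) <= C * (l * w) ^- 2.
    by apply: IH => //; [lra|rewrite exprS in tk; lra].
  have Wl : K (B (t / 2) - A (t / 2) * (l * w)) `^ (t / 2) <= l ^+ 2.
    by apply: HS'; [lra|exact: le_trans lw'].
  apply: (@le_trans _ _ (K (B (t / 2) - A (t / 2) * (l * w)) `^ t)).
    by apply: ge0_ler_powR => //; rewrite ?nnegrE ?(ltW t0).
  rewrite [X in _ `^ X](_ : _ = t / 2 * 2%:R); last by field.
  rewrite powRrM powR_mulrn ?powR_ge0// expr2.
  have -> : C * w ^- 2 = l ^+ 2 * (C * (l * w) ^- 2).
    by rewrite exprMn; field; rewrite !gt_eqF.
  by rewrite ler_pM ?powR_ge0.
near=> t => w Mw.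
have Nt : N <= t by near: t; apply: nbhs_pinfty_ge; exact: num_real.
have [k tk] : exists k, t <= 2 ^+ k * (2 * N).
  by apply: exists_exp2_bound; exact: mulr_gt0.
by apply: (main k) => //; rewrite (le_trans _ Mw)// ger_pMl// ltW.
Unshelve. all: by end_near. Qed.

End tails.

(** * Affine substitution and an integrable bound *)

Section lebesgue_integral.
Context {R : realType}.
Local Notation mu := (@lebesgue_measure R).
Local Open Scope ereal_scope.

Lemma measurable_affine (a b : R) : measurable_fun setT
  ((fun z => a * z + b)%R : measurableTypeR R -> measurableTypeR R).
Proof.
apply: continuous_measurable_fun => z; apply: cvgD; last exact: cvg_cst.
by apply: cvgM; [exact: cvg_cst|exact: cvg_id].
Qed.

Lemma lebesgue_measure_affine (a b : R) (a0 : (0 < a)%R) (S : set R) :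
  measurable S ->
  mu S = a%:E * pushforward mu ((fun z : R => a * z + b)%R : _ -> measurableTypeR R) S.
Proof.
pose f : measurableTypeR R -> measurableTypeR R := (fun z => a * z + b)%R.
have mf : measurable_fun setT f by exact: measurable_affine.
pose f' : {mfun measurableTypeR R >-> measurableTypeR R} :=
  HB.pack f (isMeasurableFun.Build _ _ _ _ f mf).
move=> mS; rewrite (@lebesgue_measure_unique _
  (mscale (NngNum (ltW a0)) (pushforward mu f')))//.
move=> _ [[c d] _ <-]; change (mu `]c, d]%classic = a%:E * mu (f @^-1` `]c, d]%classic)).
have -> : f @^-1` `]c, d]%classic = `]((c - b) / a)%R, ((d - b) / a)%R]%classic.
  apply/seteqP; split => z /=; rewrite !in_itv/= /f.
    by rewrite ltr_pdivrMr// ler_pdivlMr// ltrBlDr lerBrDr mulrC.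
  by rewrite ltr_pdivrMr// ler_pdivlMr// ltrBlDr lerBrDr mulrC.
rewrite !lebesgue_measure_itv/= !lte_fin ltr_pM2r ?invr_gt0// ltrD2r.
case: ifPn => _; last by rewrite mule0.
by rewrite -!EFinD -EFinM; congr _%:E; field; rewrite gt_eqF.
Qed.

Lemma ge0_integral_affine (a b : R) (f : R -> \bar R) : (0 < a)%R ->
  measurable_fun setT f -> (forall x, 0 <= f x) ->
  \int[mu]_x f x = a%:E * \int[mu]_z f (a * z + b)%R.
Proof.
move=> a0 mf f0.
pose g : measurableTypeR R -> measurableTypeR R := (fun z => a * z + b)%R.
have mg : measurable_fun setT g by exact: measurable_affine.
pose g' : {mfun measurableTypeR R >-> measurableTypeR R} :=
  HB.pack g (isMeasurableFun.Build _ _ _ _ g mg).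
rewrite (@eq_measure_integral _ _ _ setT
  (mscale (NngNum (ltW a0)) (pushforward mu g'))); last first.
  by move=> A mA _; rewrite /= (lebesgue_measure_affine b a0).
by rewrite ge0_integral_mscale// ge0_integral_pushforward//= preimage_setT.
Qed.

Lemma integrable_oneDabs_powR (p : R) : (1 < p)%R ->
  mu.-integrable setT (fun z : R => ((1 + `|z|) `^ (- p))%:E).
Proof.
move=> p1; pose G (z : R) : R := ((1 + `|z|) `^ (- p))%R.
have cG : continuous G.
  move=> z; apply: cvg_powR_comp; last exact: cvg_cst.
    by rewrite ltr_pwDl.
  by apply: cvgD; [exact: cvg_cst|exact: norm_continuous].
have mG : measurable_fun setT (EFin \o G).
  by apply/measurable_EFinP; exact: continuous_measurable_fun.
have G0 x : (0 <= (G x)%:E) by rewrite lee_fin powR_ge0.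
have half : \int[mu]_(z in `[0%R, +oo[) (G z)%:E < +oo.
  have p10 : (1 - p != 0)%R by rewrite lt_eqF// subr_lt0.
  pose F (z : R) : R := ((1 - p)^-1 * (z + 1) `^ (1 - p))%R.
  have dF (x : R) : (0 <= x)%R -> is_derive x 1%R F (G x).
    move=> x0; have x1 : (0 < x + 1)%R by rewrite ltr_wpDl.
    have D1 : is_derive x 1%R ((@powR R ^~ (1 - p)) \o shift 1)%R
        ((1 - p) * (x + 1) `^ (1 - p - 1) * 1)%R.
      by apply: is_derive1_comp; [exact: is_derive1_powR|exact: is_derive_shift].
    have -> : G x = ((1 - p)^-1 *: ((1 - p) * (x + 1) `^ (1 - p - 1) * 1))%R.
      rewrite /G ger0_norm// addrC [(1 - p - 1)%R]addrAC subrr add0r.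
      by rewrite mulr1 /GRing.scale/= mulKf.
    exact: is_deriveZ.
  have F0 : F x @[x --> +oo%R] --> 0%R.
    rewrite -(mulr0 (1 - p)^-1)%R; apply: cvgM; first exact: cvg_cst.
    have : expR (- ((p - 1) * ln (x + 1)))%R @[x --> +oo%R] --> (0 : R)%R.
      apply: (@cvg_comp _ _ _ (fun x : R => (p - 1) * ln (x + 1))%R
        (fun y => expR (- y))); last exact: cvgr_expR.
      apply: gt0_cvgMry; first by rewrite subr_gt0.
      apply/cvgryPge => a; near=> x.
      have ax : (expR a <= x)%R.
        by near: x; apply: nbhs_pinfty_ge; exact: num_real.
      rewrite -[leLHS]expRK ler_ln ?posrE ?expR_gt0//.
        by rewrite (le_trans ax)// lerDl.
      by rewrite ltr_wpDl// (le_trans _ ax)// expR_ge0.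
    apply: cvg_trans; apply: near_eq_cvg; near=> x => /=.
    have x0 : (0 < x)%R by near: x; exact: nbhs_pinfty_gt.
    by rewrite /powR gt_eqF ?ltr_wpDl ?(ltW x0)// -mulNr opprB.
  rewrite (ge0_continuous_FTC2y _ _ F0)/=.
  - by rewrite -EFinB ltry.
  - by move=> x _; exact: powR_ge0.
  - by apply: continuous_subspaceT; exact: cG.
  - by move=> x x0; have [] := dF x (ltW x0).
  - apply: cvg_at_right_filter; apply: differentiable_continuous.
    by apply/derivable1_diffP; have [] := dF _ (lexx 0%R).
  - move=> x; rewrite in_itv/= andbT => x0.
    by rewrite derive1E; have [_ ->] := dF x (ltW x0).
apply/integrableP; split => //.
under eq_integral do rewrite gee0_abs//.
have -> : [set: R] = `]-oo, 0%R]%classic `|` `]0%R, +oo[%classic.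
  by rewrite -setCitvr setvU.
rewrite ge0_integral_setU//=; first last.
- by rewrite disj_set2E; apply/eqP; rewrite -setCitvr setICl.
- exact: measurable_funTS.
rewrite lte_add_pinfty//.
  rewrite (_ : \int[mu]_(z in _) _ = \int[mu]_(z in `]-oo, 0%R]) (G (- z))%:E).
    by rewrite -(ge0_integration_by_substitution0 mG).
  by apply: eq_integral => z _; rewrite /G normrN.
apply: le_lt_trans half; apply: ge0_subset_integral => //.
  exact: measurable_funTS.
by apply: subset_itvr; rewrite bnd_simp.
Unshelve. all: by end_near. Qed.

End lebesgue_integral.

(** * Increments of the integrated tail *)

Section gev_spread.
Context {R : realType} {xi : R}.
Local Notation mu := (@lebesgue_measure R).

Lemma gev_bounds (z : R) : 0 <= gev xi z <= 1.
Proof.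
case: (gev_quantile_range xi z) => [[u ->]|[_ ->]|[_ ->]]; rewrite ?lexx ?ler01//.
by rewrite gev_quantileK !ltW ?gumbel_gt0 ?gumbel_lt1.
Qed.

(** A point between two quantiles is itself a quantile: outside their range it would
    lie beyond the quantiles at [- 1] or at [2] as well. *)
Lemma gev_between (z : R) : gev_quantile xi 0 <= z <= gev_quantile xi 1 ->
  gumbel 0 <= gev xi z <= gumbel 1.
Proof.
move=> /andP[z0 z1]; have q_le u v : gev_quantile xi u <= gev_quantile xi v -> u <= v.
  by rewrite !leNgt; apply: contra => vu; exact: gev_quantile_lt.
case: (gev_quantile_range xi z) => [[u zu]|[zq _]|[qz _]].
- rewrite zu in z0 z1 *; rewrite gev_quantileK.
  have g_le (v w : R) : v <= w -> gumbel v <= gumbel w.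
    by rewrite le_eqVlt => /predU1P[->//|/gumbel_lt/ltW].
  by apply/andP; split; apply: g_le; exact: q_le.
- have /q_le := le_trans z0 (zq (- 1)); lra.
- have /q_le := le_trans (qz 2) z1; lra.
Qed.

Lemma integral_gev_gt0 : measurable_fun setT (fun z => gev xi z * (1 - gev xi z)) ->
  (0 < \int[mu]_z (gev xi z * (1 - gev xi z))%:E)%E.
Proof.
move=> mg; set q0 := gev_quantile xi 0; set q1 := gev_quantile xi 1.
have q01 : q0 < q1 by exact: gev_quantile_lt.
pose c : R := gumbel 0 * (1 - gumbel 1).
have c0 : 0 < c by rewrite mulr_gt0 ?gumbel_gt0// subr_gt0 gumbel_lt1.
have g0 z : (0 <= (gev xi z * (1 - gev xi z))%:E)%E.
  by have /andP[? ?] := gev_bounds z; rewrite lee_fin mulr_ge0// subr_ge0.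
apply: (@lt_le_trans _ _ (\int[mu]_(z in `[q0, q1]) (cst c%:E) z)%E).
  rewrite integral_cst//= lebesgue_measure_itv/= lte_fin q01 -EFinD -EFinM lte_fin.
  by rewrite mulr_gt0// subr_gt0.
apply: (@le_trans _ _ (\int[mu]_(z in `[q0, q1]) (gev xi z * (1 - gev xi z))%:E)%E).
  apply: ge0_le_integral => //=.
  - by move=> z _; rewrite lee_fin ltW.
  - by apply/measurable_EFinP; exact: measurable_funTS.
  - move=> z; rewrite in_itv/= => /gev_between/andP[g1 g2]; rewrite lee_fin.
    rewrite ler_pM ?lerD2l ?lerN2//; first exact/ltW/gumbel_gt0.
    by rewrite subr_ge0 ltW// gumbel_lt1.
by apply: ge0_subset_integral => //; exact/measurable_EFinP.
Qed.

End gev_spread.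

Section increments.
Context {R : realType} {K A B : R -> R} {xi : R}.
Hypothesis K_nd : {homo K : y z / y <= z}.
Hypothesis K_ge0 : forall y : R, 0 <= K y.
Hypothesis K_le1 : forall y : R, K y <= 1.
Hypothesis K_lt0 : forall y : R, y < 0 -> K y = 0.
Hypothesis A_gt0 : forall t, 0 < A t.
Hypothesis BA : forall M, exists C, forall t, t <= M -> `|B t| / A t <= C.
Hypothesis KA : attracted xi K A B.
Local Notation mu := (@lebesgue_measure R).

Let k (t z : R) : R := K (A t * z + B t) `^ t.

Let k_ge0 t z : 0 <= k t z.
Proof. exact: powR_ge0. Qed.

Let powK_le1 (t y : R) : 0 <= t -> K y `^ t <= 1.
Proof. by move=> t0; rewrite powR_le1 ?K_ge0 ?K_le1. Qed.

Let k_nd (t x y : R) : 0 <= t -> x <= y -> k t x <= k t y.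
Proof.
by move=> t0 xy; rewrite ge0_ler_powR ?nnegrE// K_nd// lerD2r ler_pM2l.
Qed.

(** At quantiles this is the hypothesis; elsewhere all quantiles lie on one side of
    [z], and monotonicity squeezes the powers to 0 or to 1. *)
Lemma cvg_attracted_gev (z : R) : k t z @[t --> +oo] --> gev xi z.
Proof.
case: (gev_quantile_range xi z) => [[u ->]|[zq ->]|[qz ->]].
- by rewrite gev_quantileK; exact: KA.
- apply/cvgr0Pnorm_lt => e e0; have [u ue] := gumbel_small e0.
  near=> t; have t0 : 0 < t by near: t; exact: nbhs_pinfty_gt.
  rewrite ger0_norm//; apply: (le_lt_trans (k_nd (ltW t0) (zq u))).
  by near: t; exact: (cvgr_lt _ (@KA u)).
- apply/cvgrPdist_lt => e e0; have [u ue] := gumbel_large e0.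
  near=> t; have t0 : 0 < t by near: t; exact: nbhs_pinfty_gt.
  rewrite ger0_norm ?subr_ge0 ?powK_le1 ?(ltW t0)// ltrBlDr -ltrBlDl.
  apply: (lt_le_trans _ (k_nd (ltW t0) (qz u))).
  by near: t; exact: (cvgr_gt _ (@KA u)).
Unshelve. all: by end_near. Qed.

(** The two tail bounds, joined by the trivial bound at bounded arguments. *)
Lemma increment_dominated : xi < 1 -> exists p C : R, [/\ 1 < p, 0 < C &
  \forall t \near +oo, forall z, k t z * (1 - k t z) <= C * (1 + `|z|) `^ (- p)].
Proof.
move=> xi1.
have [p [C1 [M1 [p1 p2 C10 M10 HR]]]] :=
  right_tail_bound K_nd K_ge0 A_gt0 KA xi1.
have [C2 [M2 [C20 M20 HL]]] :=
  left_tail_bound K_nd K_ge0 K_le1 A_gt0 KA K_lt0 BA.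
have p0 : 0 < p by lra.
pose M : R := M1 + M2 + 1.
have M0 : 0 < M by rewrite /M; lra.
pose C := (1 + M) `^ p + 2 `^ p * (2 * C1 + C2).
exists p, C; split => //.
  by rewrite /C addr_gt0 ?mulr_gt0 ?powR_gt0//; lra.
near=> t => z.
have t1 : 1 <= t by near: t; exact: nbhs_pinfty_ge.
have t0 : 0 < t by lra.
have k1 : 0 <= 1 - k t z by rewrite subr_ge0 powK_le1// ltW.
have z1 : 0 < 1 + `|z| by rewrite ltr_pwDl.
rewrite powRN ler_pdivlMr ?powR_gt0// mulrC.
have kk1 : k t z * (1 - k t z) <= 1 by have := k_ge0 t z; nra.
have C1p : 0 < 2 `^ p * (2 * C1) by rewrite mulr_gt0 ?powR_gt0//; lra.
have C2p : 0 < 2 `^ p * C2 by rewrite mulr_gt0 ?powR_gt0.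
have M1p : 0 < (1 + M) `^ p by rewrite powR_gt0; lra.
have far : M <= `|z| -> (1 + `|z|) `^ p <= 2 `^ p * `|z| `^ p.
  move=> Mz; have z2 : 1 + `|z| <= 2 * `|z| by move: Mz; rewrite /M; lra.
  rewrite -powRM//; apply: ge0_ler_powR z2; rewrite ?nnegrE ?(ltW p0) ?(ltW z1)//.
have [zM|Mz] := ltP `|z| M.
  have : (1 + `|z|) `^ p <= (1 + M) `^ p.
    apply: ge0_ler_powR; rewrite ?nnegrE ?(ltW p0) ?(ltW z1)//; lra.
  have := powR_ge0 (1 + `|z|) p; rewrite /C; nra.
have {}far := far Mz.
have z0p : 0 < `|z| `^ p by rewrite powR_gt0; lra.
suff : k t z * (1 - k t z) <= (2 * C1 + C2) * `|z| `^ (- p).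
  rewrite powRN ler_pdivlMr// => kz.
  have : (1 + `|z|) `^ p * (k t z * (1 - k t z)) <=
      2 `^ p * `|z| `^ p * (k t z * (1 - k t z)) by rewrite ler_wpM2r// mulr_ge0.
  have : 2 `^ p * (k t z * (1 - k t z) * `|z| `^ p) <= 2 `^ p * (2 * C1 + C2).
    by rewrite ler_wpM2l// powR_ge0.
  rewrite /C; nra.
have zV : 0 <= `|z| `^ (- p) by exact: powR_ge0.
have [z0|z0] := leP 0 z.
- have tail : t * (1 - K (A t * z + B t)) <= C1 * `|z| `^ (- p).
    rewrite (ger0_norm z0); have : M1 <= z.
      by move: Mz; rewrite (ger0_norm z0) /M; lra.
    by move: z {z1 far Mz z0p k1 kk1 z0 zV}; near: t; exact: HR.
  have := @onem_powR_le _ (K (A t * z + B t)) t.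
  rewrite K_ge0 K_le1 => /(_ isT t0) onek.
  have : k t z * (1 - k t z) <= 1 - k t z by have := k_ge0 t z; nra.
  have K1 : 0 <= 1 - K (A t * z + B t) by rewrite subr_ge0.
  rewrite {3}/k; nra.
- have tail : k t z <= C2 * `|z| ^- 2.
    have zN : z = - `|z| by rewrite ltr0_norm// opprK.
    rewrite {1}zN /k mulrN addrC; have : M2 <= `|z| by move: Mz; rewrite /M; lra.
    move: (`|z|) => w; clear z z1 far Mz z0p k1 kk1 z0 zV zN.
    by move: w; near: t; exact: HL.
  have : `|z| ^- 2 <= `|z| `^ (- p).
    rewrite -powR_invn// ler_powR; [by []| |by rewrite lerN2].
    by move: Mz; rewrite /M; lra.
  have := k_ge0 t z.
  nra.
Unshelve. all: by end_near. Qed.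

Let measurable_powK (t : R) : measurable_fun setT (fun y => K y `^ t).
Proof.
apply: (measurableT_comp (measurable_powR t)).
exact: nondecreasing_measurable.
Qed.

Let measurable_k (t : R) : measurable_fun setT (k t).
Proof.
apply: (measurableT_comp (measurable_powR t)).
apply: nondecreasing_measurable => //.
by move=> x y xy; rewrite K_nd// lerD2r ler_pM2l.
Qed.

Let measurable_kk (t : R) : measurable_fun setT (fun z => k t z * (1 - k t z)).
Proof. by apply: measurable_funM => //; exact: measurable_funB. Qed.

Lemma integral_increment (t : R) : 0 < t ->
  (\int[mu]_y (K y `^ t - K y `^ (2 * t))%:E =
   (A t)%:E * \int[mu]_z (k t z * (1 - k t z))%:E)%E.
Proof.
move=> t0; have KE y : K y `^ t - K y `^ (2 * t) = K y `^ t * (1 - K y `^ t).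
  by rewrite mulrC powRrM (powR_mulrn 2) ?powR_ge0// expr2 mulrBr mulr1.
rewrite (@ge0_integral_affine _ _ (B t) _ (A_gt0 t)).
- by under eq_integral do rewrite KE.
- by apply/measurable_EFinP; apply: measurable_funB.
- by move=> y; rewrite lee_fin KE mulr_ge0 ?powR_ge0// subr_ge0 powK_le1// ltW.
Qed.

(** Dominated convergence for the integrand in rescaled arguments. *)
Lemma cvg_increment : xi < 1 -> exists2 J : R, 0 < J &
  fine (\int[mu]_y (K y `^ t - K y `^ (2 * t))%:E)%E / A t @[t --> +oo] --> J.
Proof.
move=> xi1; pose g (z : R) : R := gev xi z * (1 - gev xi z).
have [p [C [p1 C0 [S [_ HS]]]]] := increment_dominated xi1.
have ck (z : R) : k t z * (1 - k t z) @[t --> +oo] --> g z.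
  apply: cvgM; first exact: cvg_attracted_gev.
  by apply: cvgB; [exact: cvg_cst|exact: cvg_attracted_gev].
have DC (v : R^nat) : v n @[n --> \oo] --> +oo ->
    mu.-integrable setT (EFin \o g) /\
    (\int[mu]_z (k (v n) z * (1 - k (v n) z))%:E)%E @[n --> \oo]
      --> (\int[mu]_z (g z)%:E)%E.
  (* the bound holds from some time on, so the sequence is shifted by [N] *)
  move=> vy; have /cvgryPgt /(_ (Num.max S 0)) [N _ HN] := vy.
  have {}HN n : S < v (n + N)%N /\ 0 < v (n + N)%N.
    by have := HN (n + N)%N (leq_addl _ _); rewrite /= gt_max => /andP.
  have vNy : v (n + N)%N @[n --> \oo] --> +oo by rewrite cvg_shiftn.
  have cN (z : R) : k (v (n + N)%N) z * (1 - k (v (n + N)%N) z) @[n --> \oo] --> g z.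
    exact: (cvg_comp _ _ vNy (ck z)).
  have mg : measurable_fun setT g.
    by apply: (@measurable_fun_cvg _ _ _ _
      (fun n z => k (v (n + N)%N) z * (1 - k (v (n + N)%N) z))).
  pose f n (z : R) : \bar R := (k (v (n + N)%N) z * (1 - k (v (n + N)%N) z))%:E.
  pose G (z : R) : \bar R := (C%:E * ((1 + `|z|) `^ (- p))%:E)%E.
  have mf n : measurable_fun setT (f n) by exact/measurable_EFinP.
  have mg' : measurable_fun setT (EFin \o g) by exact/measurable_EFinP.
  have fg : {ae mu, forall z, setT z -> f ^~ z @ \oo --> (EFin \o g) z}.
    by apply: aeW => z _; apply: cvg_EFin; [exact: nearW|exact: cN].
  have iG : mu.-integrable setT G by exact/integrableZl/integrable_oneDabs_powR.
  have fG : {ae mu, forall z n, setT z -> (`|f n z| <= G z)%E}.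
    apply: aeW => z n _; have [Sv v0] := HN n.
    rewrite /f /G -EFinM gee0_abs ?lee_fin; first exact: HS.
    by rewrite mulr_ge0// subr_ge0 powK_le1// ltW.
  have [ig _ cI] := @dominated_convergence _ _ _ mu setT measurableT f (EFin \o g) G
    mf mg' fg iG fG.
  split; first exact: ig.
  have <- := cvg_shiftn N
    (fun n => (\int[mu]_z (k (v n) z * (1 - k (v n) z))%:E)%E)
    (nbhs (\int[mu]_z (g z)%:E)%E).
  exact: cI.
have [ig _] := DC (fun n => n%:R) (@cvgr_idn R).
have mg : measurable_fun setT g by apply/measurable_EFinP; exact: measurable_int ig.
have gE : ((fine (\int[mu]_z (g z)%:E))%:E = \int[mu]_z (g z)%:E)%E.
  by apply: fineK; exact: (integrable_fin_num measurableT ig).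
exists (fine (\int[mu]_z (g z)%:E)%E).
  rewrite -lte_fin gE; exact: integral_gev_gt0.
have : fine (\int[mu]_z (k t z * (1 - k t z))%:E)%E @[t --> +oo] -->
    fine (\int[mu]_z (g z)%:E)%E.
  by apply/cvg_pinftyP => v /DC[_]; rewrite -gE => /fine_cvg.
apply: cvg_trans; apply: near_eq_cvg; near=> t.
have t0 : 0 < t by near: t; exact: nbhs_pinfty_gt.
rewrite integral_increment//; have At := A_gt0 t.
(* [fine] sends infinite values to 0 on both sides *)
case: (\int[mu]_z _)%E => [r| |] /=.
- by rewrite mulrAC divff ?mul1r// gt_eqF.
- by rewrite gt0_muley ?lte_fin//= mul0r.
- by rewrite gt0_muleNy ?lte_fin//= mul0r.
Unshelve. all: by end_near. Qed.

End increments.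

(** * From doubling increments to the function *)

Lemma cvg_exp2_pinfty (R : realType) : (2 ^+ n : R) @[n --> \oo] --> +oo.
Proof.
apply/cvgryPge => M; near=> n.
apply: (@le_trans _ _ n%:R); first by near: n; exact: nbhs_infty_ger.
by rewrite -natrX ler_nat ltnW// ltn_expl.
Unshelve. all: by end_near. Qed.

Section doubling.
Context {R : realType} {H : R -> R} {c rho : R}.
Hypothesis H_nd : {homo H : s t / s <= t}.
Hypothesis c_gt0 : 0 < c.
Let D (t : R) : R := H (2 * t) - H t.
Hypothesis D_gt0 : \forall t \near +oo, 0 < D t.
Hypothesis D_ratio : D (c * t) / D t @[t --> +oo] --> rho.

Let near_increment (e : R) : 0 < e -> exists2 S : R, 0 < S &
  forall t, S <= t -> 0 < D t /\ `|D (c * t) - rho * D t| <= e * D t.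
Proof.
move=> e0; have /cvgrPdist_lt /(_ _ e0) De := D_ratio.
have : \forall t \near +oo, 0 < D t /\ `|D (c * t) - rho * D t| <= e * D t.
  near=> t; have Dt : 0 < D t by near: t.
  split=> //; rewrite -[X in _ <= e * X](gtr0_norm Dt) -ler_pdivrMr ?normr_gt0 ?gt_eqF//.
  rewrite -normf_div mulrBl mulfK ?gt_eqF// distrC ltW//.
  by near: t.
move=> [S [_ HS]]; exists (Num.max S 0 + 1).
  by rewrite ltr_wpDl// le_max lexx orbT.
move=> t St; apply: HS; apply: lt_le_trans St.
by rewrite ltr_pwDr// le_max lexx.
Unshelve. all: by end_near. Qed.

(** Telescoping from [t] down by halving, [H (c * t)] and [rho * H t] differ by at most
    a small multiple of [H t] and a contribution of bounded times, which is negligible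
    as [H] is unbounded. *)
Lemma ratio_from_increments_pinfty : (forall t, 0 <= H t) ->
  H t @[t --> +oo] --> +oo -> H (c * t) / H t @[t --> +oo] --> rho.
Proof.
move=> H0 Hy; apply/cvgrPdist_le => e e0.
have e20 : 0 < e / 2 by exact: divr_gt0.
have [S S0 HS] := near_increment e20.
pose C := H (c * (2 * S)) + `|rho| * H (2 * S).
have C0 : 0 <= C by rewrite addr_ge0// mulr_ge0.
(* [C] bounds the left-hand side for [t] between [S] and [2 * S] *)
have main k (t : R) : S <= t -> t <= 2 ^+ k * (2 * S) ->
    `|H (c * t) - rho * H t| <= e / 2 * H t + C.
  elim: k t => [|k IH] t St tk.
    rewrite mul1r in tk; apply: (@le_trans _ _ C); last first.
      by rewrite lerDr mulr_ge0// ltW.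
    apply: (le_trans (ler_normB _ _)); rewrite normrM.
    rewrite (ger0_norm (H0 (c * t))) (ger0_norm (H0 t)).
    rewrite lerD//; first by rewrite H_nd// ler_pM2l.
    by rewrite ler_wpM2l// H_nd.
  have [t2|t2] := leP t (2 * S).
    by apply: IH => //; rewrite (le_trans t2)// ler_peMl ?exprn_ege1//; lra.
  have St2 : S <= t / 2 by lra.
  have {}IH : `|H (c * (t / 2)) - rho * H (t / 2)| <= e / 2 * H (t / 2) + C.
    by apply: IH => //; rewrite exprS in tk; lra.
  have [_] := HS _ St2.
  rewrite /D [2 * (c * _)]mulrCA [2 * (t / 2)]mulrC divfK// => HD.
  have -> : H (c * t) - rho * H t = (H (c * (t / 2)) - rho * H (t / 2)) +
    (H (c * t) - H (c * (t / 2)) - rho * (H t - H (t / 2))) by ring.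
  by rewrite (le_trans (ler_normD _ _))//; lra.
near=> t.
have H1 : Num.max 1 (C / (e / 2)) <= H t by near: t; exact: (cvgryPge _).1.
move: H1; rewrite ge_max ler_pdivrMr// => /andP[H1 CH].
have Ht : 0 < H t by lra.
have St : S <= t by near: t; apply: nbhs_pinfty_ge; exact: num_real.
have [k tk] : exists k, t <= 2 ^+ k * (2 * S).
  by apply: exists_exp2_bound; exact: mulr_gt0.
have := main k t St tk => Hm.
rewrite distrC -[X in _ - X](mulfK (lt0r_neq0 Ht)) -mulrBl normrM normfV.
rewrite [`|H t|]gtr0_norm// ler_pdivrMr//; lra.
Unshelve. all: by end_near. Qed.

(** The telescoping goes upwards here, by doubling; its end term vanishes in the
    limit. *)
Lemma ratio_from_increments_lim (l : R) : H t @[t --> +oo] --> l ->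
  (l - H (c * t)) / (l - H t) @[t --> +oo] --> rho.
Proof.
move=> Hl; apply/cvgrPdist_le => e e0.
have [S S0 HS] := near_increment e0.
have lH t : H t <= l.
  apply: (cvgr_to_ge Hl); near=> s; apply: H_nd.
  by near: s; apply: nbhs_pinfty_ge; exact: num_real.
pose h t := l - H t.
have main n (t : R) : S <= t -> `|h (c * t) - rho * h t| <=
    e * (h t - h (2 ^+ n * t)) + `|h (c * (2 ^+ n * t)) - rho * h (2 ^+ n * t)|.
  elim: n t => [|n IH] t St; first by rewrite !mul1r subrr mulr0 add0r.
  have [Dt] := HS _ St; have {IH} := IH (2 * t).
  have -> : 2 ^+ n * (2 * t) = 2 ^+ n.+1 * t by rewrite exprSr mulrA.
  rewrite [c * (2 * t)]mulrCA.
  have -> : h (c * t) - rho * h t = (h (2 * (c * t)) - rho * h (2 * t)) +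
    (D (c * t) - rho * D t) by rewrite /h /D; ring.
  move=> IH HD; rewrite (le_trans (ler_normD _ _))//.
  have {}IH := IH ltac:(lra).
  have : D t = h t - h (2 * t) by rewrite /h /D; ring.
  by move=> DE; rewrite [X in _ <= e * X]DE in HD; lra.
near=> t.
have St : S <= t by near: t; apply: nbhs_pinfty_ge; exact: num_real.
have t0 : 0 < t by exact: lt_le_trans St.
have ht : 0 < h t.
  by have [+ _] := HS _ St; rewrite /D /h; have := lH (2 * t); lra.
have hn (v : R^nat) : v n @[n --> \oo] --> +oo -> h (v n) @[n --> \oo] --> (0 : R).
  move=> vy; rewrite -(subrr l); apply: cvgB; first exact: cvg_cst.
  exact: cvg_comp vy Hl.
have key : `|h (c * t) - rho * h t| <= e * h t.
  have ny : 2 ^+ n * t @[n --> \oo] --> +oo.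
    exact: (cvg_comp _ (fun r => r * t) (@cvg_exp2_pinfty R) (gt0_cvgMly t0 cvg_id)).
  have cny : c * (2 ^+ n * t) @[n --> \oo] --> +oo.
    exact: (cvg_comp _ _ ny (gt0_cvgMry c_gt0 cvg_id)).
  have lim : e * (h t - h (2 ^+ n * t)) +
      `|h (c * (2 ^+ n * t)) - rho * h (2 ^+ n * t)| @[n --> \oo] -->
      e * (h t - 0) + `|0 - rho * 0|.
    apply: cvgD.
      apply: cvgM; first exact: cvg_cst.
      by apply: cvgB; [exact: cvg_cst|exact: hn].
    apply: cvg_norm; apply: cvgB; first exact: hn.
    by apply: cvgM; [exact: cvg_cst|exact: hn].
  rewrite mulr0 subrr normr0 addr0 subr0 in lim.
  by apply: (cvgr_to_ge lim); apply: nearW => n; exact: main.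
rewrite distrC -[X in _ - X](mulfK (lt0r_neq0 ht)) -mulrBl normrM normfV.
by rewrite [`|l - H t|]gtr0_norm// ler_pdivrMr.
Unshelve. all: by end_near. Qed.

End doubling.

(** * Regular variation of the integrated tail of powers *)

(** The mean of the maximum of [t] independent nonnegative variables with distribution
    function [K], continued to real [t]; negative [t] are sent to 0 to make it
    nondecreasing, hence measurable, on the whole line. *)
Definition integrated_tail (R : realType) (K : R -> R) (t : R) : R :=
  fine (\int[@lebesgue_measure R]_(r in `[0%R, +oo[) (1 - K r `^ Num.max t 0)%:E)%E.

Section integrated_tail.
Context {R : realType} {K : R -> R}.
Hypothesis K_nd : {homo K : y z / y <= z}.
Hypothesis K_ge0 : forall y : R, 0 <= K y.
Hypothesis K_le1 : forall y : R, K y <= 1.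
Local Notation mu := (@lebesgue_measure R).
Hypothesis K_int : (\int[mu]_(r in `[0%R, +oo[) (1 - K r)%:E < +oo)%E.
Local Notation H := (integrated_tail K).

Let powK_le1 (t y : R) : 0 <= t -> K y `^ t <= 1.
Proof. by move=> t0; rewrite powR_le1 ?K_ge0 ?K_le1. Qed.

Let measurable_powK (t : R) : measurable_fun setT (fun y => K y `^ t).
Proof.
apply: (measurableT_comp (measurable_powR t)).
exact: nondecreasing_measurable.
Qed.

Let measurable_tail (D : set R) (t : R) :
  measurable_fun D (fun y => (1 - K y `^ t)%:E).
Proof.
apply: measurable_funTS; apply/measurable_EFinP.
exact: measurable_funB.
Qed.

Let measurable_onem (D : set R) : measurable_fun D (fun y => (1 - K y)%:E).
Proof.
apply: measurable_funTS; apply/measurable_EFinP.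
by apply: measurable_funB => //; exact: nondecreasing_measurable.
Qed.

Let powK_nincr (s t y : R) : 0 <= s -> s <= t -> K y `^ t <= K y `^ s.
Proof.
move=> s0 st; have t0 := le_trans s0 st.
have [->|sn] := eqVneq s 0; first by rewrite powRr0 powK_le1.
have [->|Ky] := eqVneq (K y) 0.
  by rewrite !powR0// gt_eqF// (lt_le_trans _ st)// lt_neqAle eq_sym sn.
by rewrite ger_powR// K_le1 lt_neqAle eq_sym Ky K_ge0.
Qed.

(** Finite for every exponent because [1 - K r `^ t] is at most a multiple of
    [1 - K r]. *)
Lemma integrated_tailE (t : R) : 0 <= t ->
  (\int[mu]_(r in `[0%R, +oo[) (1 - K r `^ t)%:E)%E = (H t)%:E.
Proof.
move=> t0; rewrite /integrated_tail (max_idPl t0) fineK//.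
rewrite ge0_fin_numE; last first.
  by apply: integral_ge0 => r _; rewrite lee_fin subr_ge0 powK_le1.
apply: (@le_lt_trans _ _
  (\int[mu]_(r in `[0%R, +oo[) ((t + 1)%:E * (1 - K r)%:E))%E).
  apply: ge0_le_integral => //=.
  - by move=> r _; rewrite lee_fin subr_ge0 powK_le1.
  - exact: measurable_tail.
  - by apply: measurable_funeM; exact: measurable_onem.
  - move=> r _; rewrite -EFinM lee_fin; have [->|tn] := eqVneq t 0.
      by rewrite powRr0 subrr add0r mul1r subr_ge0.
    by rewrite onem_powR_le ?K_ge0 ?K_le1// lt_neqAle eq_sym tn.
rewrite ge0_integralZl//=.
- by rewrite lte_mul_pinfty// ?lee_fin ?addr_ge0.
- exact: measurable_onem.
- by move=> r _; rewrite lee_fin subr_ge0.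
- by rewrite lee_fin addr_ge0.
Qed.

Lemma integrated_tail_max (t : R) : H t = H (Num.max t 0).
Proof. by rewrite /integrated_tail -maxA maxxx. Qed.

Lemma integrated_tail_ge0 (t : R) : 0 <= H t.
Proof.
apply: fine_ge0; apply: integral_ge0 => r _.
by rewrite lee_fin subr_ge0 powK_le1// le_max lexx orbT.
Qed.

Lemma integrated_tail_nd : {homo H : s t / s <= t}.
Proof.
move=> s t st; rewrite (integrated_tail_max s) (integrated_tail_max t).
have m0 (v : R) : 0 <= Num.max v 0 by rewrite le_max lexx orbT.
rewrite -lee_fin -(integrated_tailE (m0 s)) -(integrated_tailE (m0 t)).
apply: ge0_le_integral => //=.
- by move=> r _; rewrite lee_fin subr_ge0 powK_le1.
- exact: measurable_tail.
- exact: measurable_tail.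
- move=> r _; rewrite lee_fin lerD2l lerN2 powK_nincr//.
  by rewrite ge_max le_max st/= le_max lexx orbT.
Qed.

(** The contribution of the interval from 0 to [m]. *)
Lemma integrated_tail_lower (t m : R) : 0 <= t -> 0 <= m ->
  m * (1 - K m `^ t) <= H t.
Proof.
move=> t0 m0; rewrite -lee_fin -integrated_tailE//.
apply: (@le_trans _ _ (\int[mu]_(r in `[0%R, m]) (1 - K r `^ t)%:E)%E); last first.
  apply: ge0_subset_integral => //; first exact: measurable_tail.
    by move=> r _; rewrite lee_fin subr_ge0 powK_le1.
  by apply: subset_itvl; rewrite bnd_simp.
apply: (@le_trans _ _ (\int[mu]_(r in `[0%R, m]) (cst (1 - K m `^ t)%:E) r)%E).
  rewrite integral_cst//= lebesgue_measure_itv/= lte_fin.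
  case: ifPn => [_|]; first by rewrite sube0 -EFinM mulrC.
  by rewrite -leNgt => m1; rewrite mule0 lee_fin (le_anti (introT andP (conj m1 m0))) mul0r.
apply: ge0_le_integral => //=.
- by move=> r _; rewrite lee_fin subr_ge0 powK_le1.
- exact: measurable_tail.
- move=> r; rewrite in_itv/= => /andP[_ rm]; rewrite lee_fin lerD2l lerN2.
  by rewrite ge0_ler_powR ?nnegrE// K_nd.
Qed.

Lemma near_integrated_tail_gt (m e : R) : 0 <= m -> K m < 1 -> 0 < e ->
  \forall t \near +oo, m - e < H t.
Proof.
move=> m0 Km e0.
have lim : m * (1 - K m `^ t) @[t --> +oo] --> m * (1 - 0).
  apply: cvgM; first exact: cvg_cst.
  by apply: cvgB; [exact: cvg_cst|exact: cvg_powR_pinfty0].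
rewrite subr0 mulr1 in lim; near=> t.
apply: (@lt_le_trans _ _ (m * (1 - K m `^ t))).
  by near: t; apply: (cvgr_gt _ lim); lra.
by apply: integrated_tail_lower => //; near: t; exact: nbhs_pinfty_ge.
Unshelve. all: by end_near. Qed.

Lemma cvg_integrated_tail_pinfty : (forall m, K m < 1) -> H t @[t --> +oo] --> +oo.
Proof.
move=> K1; apply/cvgryPgt => M; have := @near_integrated_tail_gt (`|M| + 1) 1.
rewrite addrK => /(_ _ (K1 _) ltr01) h; near=> t.
apply: (le_lt_trans (ler_norm _)); near: t; apply: h.
by rewrite addr_ge0.
Unshelve. all: by end_near. Qed.

Lemma cvg_integrated_tail (l : R) : 0 < l -> (forall m, m < l -> K m < 1) ->
  (forall m, l < m -> K m = 1) -> H t @[t --> +oo] --> l.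
Proof.
move=> l0 Kl Kl1.
have Hl (t : R) : 0 <= t -> H t <= l.
  move=> t0; rewrite -lee_fin -integrated_tailE//.
  apply: (@le_trans _ _ (\int[mu]_(r in `[0%R, +oo[) (\1_(`[0%R, l]%classic : set R) r)%:E)%E).
    apply: ge0_le_integral => //=.
    - by move=> r _; rewrite lee_fin subr_ge0 powK_le1.
    - exact: measurable_tail.
    - by apply/measurable_EFinP; exact: measurable_funTS.
    - move=> r; rewrite in_itv/= andbT => r0; rewrite lee_fin indicE.
      case: (leP r l) => rl.
        by rewrite mem_set ?lerBlDr ?lerDl ?powR_ge0//= in_itv/= r0.
      by rewrite Kl1// powR1 subrr.
  rewrite integral_indic//.
  apply: (@le_trans _ _ (mu `[0%R, l]%classic)).
    by rewrite le_measure ?inE//; exact: measurableI.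
  by rewrite lebesgue_measure_itv/= lte_fin l0 sube0.
apply/cvgrPdist_lt => e e0.
have ml : 0 <= Num.max 0 (l - e / 2) < l by rewrite le_max lexx/= gt_max l0; lra.
case/andP: ml => m0 ml; have e2 : 0 < e / 2 by exact: divr_gt0.
have := near_integrated_tail_gt m0 (Kl _ ml) e2.
move=> h; near=> t; have : 0 <= t by near: t; exact: nbhs_pinfty_ge.
move=> /Hl Htl; rewrite ger0_norm ?subr_ge0//.
have : Num.max 0 (l - e / 2) - e / 2 < H t by near: t.
have : l - e / 2 <= Num.max 0 (l - e / 2) by rewrite le_max lexx orbT.
lra.
Unshelve. all: by end_near. Qed.

Hypothesis K_lt0 : forall y : R, y < 0 -> K y = 0.

Lemma integrated_tail_increment (t : R) : 0 < t ->
  (\int[mu]_y (K y `^ t - K y `^ (2 * t))%:E = (H (2 * t) - H t)%:E)%E.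
Proof.
move=> t0; have t20 : 0 < 2 * t by exact: mulr_gt0.
have d0 y : 0 <= K y `^ t - K y `^ (2 * t).
  by rewrite subr_ge0 powK_nincr ?ltW//; lra.
have -> : (\int[mu]_y (K y `^ t - K y `^ (2 * t))%:E =
    \int[mu]_(y in `[0%R, +oo[) (K y `^ t - K y `^ (2 * t))%:E)%E.
  rewrite [RHS]integral_mkcond; apply: eq_integral => y _.
  rewrite patchE; case: ifPn => // yn; rewrite K_lt0 ?powR0 ?gt_eqF ?subrr//.
  by rewrite ltNge; apply: contra yn => y0; rewrite inE/= in_itv/= y0.
have : (\int[mu]_(r in `[0%R, +oo[) ((1 - K r `^ t)%:E + (K r `^ t - K r `^ (2 * t))%:E) =
    \int[mu]_(r in `[0%R, +oo[) (1 - K r `^ (2 * t))%:E)%E.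
  by apply: eq_integral => r _; rewrite -EFinD; congr _%:E; ring.
rewrite ge0_integralD//=; last 4 first.
- by move=> r _; rewrite lee_fin subr_ge0 powK_le1// ltW.
- exact: measurable_tail.
- by move=> r _; rewrite lee_fin.
- apply: measurable_funTS; apply/measurable_EFinP.
  by apply: measurable_funB; exact: measurable_powK.
rewrite !integrated_tailE ?ltW//.
by case: (\int[mu]_(r in _) _)%E => [r| |]//= [<-]; congr _%:E; ring.
Qed.

Context {A B : R -> R} {xi : R}.
Hypothesis A_gt0 : forall t, 0 < A t.
Hypothesis BA : forall M, exists C, forall t, t <= M -> `|B t| / A t <= C.
Hypothesis KA : attracted xi K A B.
Hypothesis xi1 : xi < 1.

Lemma near_increment_gt0 : \forall t \near +oo, 0 < H (2 * t) - H t.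
Proof.
have [J J0 DJ] := cvg_increment K_nd K_ge0 K_le1 K_lt0 A_gt0 BA KA xi1.
near=> t; have t0 : 0 < t by near: t; exact: nbhs_pinfty_gt.
have : 0 < fine (\int[mu]_y (K y `^ t - K y `^ (2 * t))%:E)%E / A t.
  by near: t; exact: (cvgr_gt _ DJ).
by rewrite integrated_tail_increment//= pmulr_lgt0// invr_gt0.
Unshelve. all: by end_near. Qed.

(** Both increments are asymptotic to the same multiple of the norming scale, and the
    latter is regularly varying. *)
Lemma cvg_increment_ratio (c : R) : 0 < c ->
  (H (2 * (c * t)) - H (c * t)) / (H (2 * t) - H t) @[t --> +oo] --> c `^ xi.
Proof.
move=> c0; have [J J0 DJ] := cvg_increment K_nd K_ge0 K_le1 K_lt0 A_gt0 BA KA xi1.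
have {}DJ : (H (2 * t) - H t) / A t @[t --> +oo] --> J.
  move: DJ; apply: cvg_trans; apply: near_eq_cvg; near=> t.
  by rewrite integrated_tail_increment//; near: t; exact: nbhs_pinfty_gt.
have cDJ : (H (2 * (c * t)) - H (c * t)) / A (c * t) @[t --> +oo] --> J.
  exact: (cvg_comp _ _ (cvg_scale_pinfty c0) DJ).
have Ac := cvg_types_scale K_nd K_ge0 A_gt0 KA c0.
have : (H (2 * (c * t)) - H (c * t)) / A (c * t) * (A (c * t) / A t) *
    ((H (2 * t) - H t) / A t)^-1 @[t --> +oo] --> J * c `^ xi * J^-1.
  by apply: cvgM; [exact: cvgM|apply: cvgV => //; rewrite gt_eqF].
rewrite mulrAC divff ?gt_eqF// mul1r.
apply: cvg_trans; apply: near_eq_cvg; near=> t.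
have D0 : 0 < H (2 * t) - H t by near: t; exact: near_increment_gt0.
have cancel (r s p q : R) : 0 < r -> 0 < p -> 0 < q ->
    s / p * (p / q) * (r / q)^-1 = s / r.
  by move=> r0 p0 q0; field; rewrite !gt_eqF.
by rewrite cancel.
Unshelve. all: by end_near. Qed.

Lemma integrated_tail_regular_pinfty (c : R) : 0 < c ->
  H t @[t --> +oo] --> +oo -> H (c * t) / H t @[t --> +oo] --> c `^ xi.
Proof.
move=> c0; exact: (ratio_from_increments_pinfty integrated_tail_nd c0
  near_increment_gt0 (cvg_increment_ratio c0) integrated_tail_ge0).
Qed.

Lemma integrated_tail_regular_lim (c l : R) : 0 < c ->
  H t @[t --> +oo] --> l -> (l - H (c * t)) / (l - H t) @[t --> +oo] --> c `^ xi.
Proof.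
move=> c0; exact: (ratio_from_increments_lim integrated_tail_nd c0
  near_increment_gt0 (cvg_increment_ratio c0)).
Qed.

(** Strict because the increment from [t] to [2 * t] is positive. *)
Lemma near_integrated_tail_lt_lim (l : R) :
  H t @[t --> +oo] --> l -> \forall t \near +oo, 0 < l - H t.
Proof.
move=> Hl; apply: filterS near_increment_gt0 => t; rewrite !subr_gt0 => Ht.
apply: (lt_le_trans Ht); apply: (cvgr_to_ge Hl); near=> s.
by apply: integrated_tail_nd; near: s; apply: nbhs_pinfty_ge; exact: num_real.
Unshelve. all: by end_near. Qed.

End integrated_tail.

Lemma slowly_varying_rescale (R : realType) (G : R -> R) (xi k : R) :
  0 < k -> measurable_fun setT G -> (\forall t \near +oo, 0 < G t) ->
  (forall c, 0 < c -> G (c * t) / G t @[t --> +oo] --> c `^ xi) ->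
  slowly_varying (fun t => k * G t * t `^ (- xi)).
Proof.
move=> k0 mG G0 Gc; split.
- apply: measurable_funTS; apply: measurable_funM; first exact: measurable_funM.
  exact: measurable_powR.
- near=> t; have t0 : 0 < t by near: t; exact: nbhs_pinfty_gt.
  have Gt : 0 < G t by near: t.
  by rewrite !mulr_gt0 ?powR_gt0.
- move=> c c0; have : G (c * t) / G t * c `^ (- xi) @[t --> +oo] --> c `^ xi * c `^ (- xi).
    by apply: cvgM; [exact: Gc|exact: cvg_cst].
  rewrite powRN mulfV ?gt_eqF ?powR_gt0//.
  apply: cvg_trans; apply: near_eq_cvg; near=> t.
  have t0 : 0 < t by near: t; exact: nbhs_pinfty_gt.
  have Gt : 0 < G t by near: t.
  rewrite powRM ?ltW// !powRN; field.
  by rewrite !gt_eqF ?powR_gt0.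
Unshelve. all: by end_near. Qed.

(** * The sample maximum *)

Section sample_max.
Context {R : realType} {d : measure_display} {T : measurableType d}.
Context {P : probability T R} {X : nat -> {RV P >-> R}}.
Hypothesis X_iid : iid X.
Local Notation F := (distr_fun (X 0%N)).
Local Notation Z := (sample_max (fun i => X i : T -> R)).
Local Notation mu := (@lebesgue_measure R).

Lemma cdf_distr_fun (Y : {RV P >-> R}) (y : R) : cdf Y y = (distr_fun Y y)%:E.
Proof. by rewrite /distr_fun fineK// fin_num_measure. Qed.

Lemma distr_fun_nd (Y : {RV P >-> R}) : {homo distr_fun Y : y z / y <= z}.
Proof.
by move=> y z yz; rewrite -lee_fin -!cdf_distr_fun cdf_nondecreasing.
Qed.

Lemma distr_fun_ge0 (Y : {RV P >-> R}) (y : R) : 0 <= distr_fun Y y.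
Proof. by rewrite -lee_fin -cdf_distr_fun. Qed.

Lemma distr_fun_le1 (Y : {RV P >-> R}) (y : R) : distr_fun Y y <= 1.
Proof. by rewrite -lee_fin -cdf_distr_fun probability_le1. Qed.

(** The layer-cake formula, with the tail of the excess read off the tail of [Y]. *)
Lemma expectation_excess (Y : {RV P >-> R}) (x : R) :
  ('E_P[(fun w => Num.max (Y w - x) 0)%R] =
   \int[mu]_(r in `[0%R, +oo[) (1 - distr_fun Y (x + r))%:E)%E.
Proof.
pose f (w : T) : R := Num.max (Y w - x) 0.
have mf : measurable_fun setT f.
  by apply: measurable_maxr => //; exact: measurable_funB.
pose f' : {RV P >-> R} := HB.pack f (isMeasurableFun.Build _ _ _ _ f mf).
rewrite (_ : expectation P _ = 'E_P[f'])%E// ge0_expectation_ccdf; last first.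
  by move=> w; rewrite /= /f le_max lexx orbT.
apply: eq_integral => r; rewrite inE/= in_itv/= andbT => r0.
rewrite ccdf_1_cdf EFinB -cdf_distr_fun; congr (_ - _)%E.
rewrite /cdf /distribution /pushforward; congr (P _).
apply/seteqP; split => w /=; rewrite !in_itv/= /f ge_max r0 andbT => ?; lra.
Qed.

Lemma sample_max_le (n : nat) (w : T) (y : R) : (0 < n)%N ->
  (Z n w <= y) = all (fun i => X i w <= y) (index_iota 1 n.+1).
Proof.
move=> n0; rewrite /sample_max.
have H (s : seq nat) : (\big[Num.max/X 1%N w]_(i <- s) X i w <= y) =
    (X 1%N w <= y) && all (fun i => X i w <= y) s.
  elim: s => [|i s IH]; first by rewrite big_nil andbT.
  by rewrite big_cons ge_max IH /= andbCA.
rewrite H; case: n n0 => // n _.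
by rewrite /index_iota subSS subn0 /= andbA andbb.
Qed.

Lemma measurable_sample_max (n : nat) : measurable_fun setT (Z n).
Proof.
rewrite /sample_max; elim: (index_iota _ _) => [|i s IH].
  under eq_fun do rewrite big_nil.
  exact: measurable_funPT.
by under eq_fun do rewrite big_cons; exact: measurable_maxr.
Qed.

(** The maximum bundled as a random variable, so that it has a distribution. *)
Definition sample_max_RV (n : nat) : {RV P >-> R} :=
  HB.pack (Z n) (isMeasurableFun.Build _ _ _ _ (Z n) (measurable_sample_max n)).

Lemma distr_fun_sample_max (n : nat) (y : R) : (0 < n)%N ->
  distr_fun (sample_max_RV n) y = F y ^+ n.
Proof.
move=> n0; apply: EFin_inj; rewrite -cdf_distr_fun.
have [ind idd] := X_iid.
have := ind (index_iota 1 n.+1) (fun=> `]-oo, y]%classic) (iota_uniq _ _)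
  (fun=> measurable_itv _).
have -> : \bigcap_(i in [set` index_iota 1 n.+1]) (X i @^-1` `]-oo, y]%classic) =
    sample_max_RV n @^-1` `]-oo, y]%classic.
  apply/seteqP; split => w /=.
    move=> h; rewrite in_itv/= sample_max_le//; apply/allP => i /h.
    by rewrite /= in_itv.
  rewrite in_itv/= sample_max_le// => /allP h i /h /=; by rewrite in_itv.
rewrite /cdf /distribution /pushforward => ->.
under eq_bigr => i _.
  rewrite (_ : P (X i @^-1` _) = (F y)%:E); last first.
    by rewrite -cdf_distr_fun; exact: (idd i 0%N).
  over.
by rewrite prodEFin big_const_seq count_predT size_iota subSS subn0 iter_mulr_1.
Qed.

End sample_max.

(** * Expected excess and gap *)

Lemma right_endpoint_lt1 (R : realType) (F : R -> R) (y : R) :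
  {homo F : y z / y <= z} -> (y%:E < right_endpoint F)%E -> F y < 1.
Proof.
move=> F_nd /ereal_sup_gt[_ [z [_ Fz] <-]]; rewrite lte_fin => yz.
by rewrite (le_lt_trans _ Fz)// F_nd// ltW.
Qed.

Lemma right_endpoint_ge1 (R : realType) (F : R -> R) (y : R) :
  0 <= y -> (right_endpoint F < y%:E)%E -> 1 <= F y.
Proof.
move=> y0 Fy; rewrite leNgt; apply/negP => Fy1.
move: Fy; rewrite ltNge => /negP; apply.
by apply: ereal_sup_ubound; exists y.
Qed.

(** The distribution function of the excess over [x] of a variable with distribution
    function [F]. *)
Definition excess_distr (R : realType) (F : R -> R) (x r : R) : R :=
  if r < 0 then 0 else F (x + r).

Section expected_excess.
Context {R : realType} {d : measure_display} {T : measurableType d}.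
Context {P : probability T R} {X : nat -> {RV P >-> R}}.
Hypothesis X_iid : iid X.
Hypothesis X_ge0 : forall i w, 0 <= X i w.
Hypothesis X_int : ('E_P[X 0%N] < +oo)%E.
Local Notation F := (distr_fun (X 0%N)).
Local Notation Z := (sample_max (fun i => X i : T -> R)).
Local Notation mu := (@lebesgue_measure R).
Context {x : R}.
Hypothesis x_gt0 : 0 < x.
Local Notation K := (excess_distr F x).

Lemma excess_distr_nd : {homo K : y z / y <= z}.
Proof.
move=> y z yz; rewrite /excess_distr; case: (ltP z 0) => z0.
  by rewrite (le_lt_trans yz z0).
by case: ifPn => _; [exact: distr_fun_ge0|rewrite distr_fun_nd ?lerD2l].
Qed.

Lemma excess_distr_ge0 (y : R) : 0 <= K y.
Proof. by rewrite /excess_distr; case: ifPn => // _; exact: distr_fun_ge0. Qed.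

Lemma excess_distr_le1 (y : R) : K y <= 1.
Proof. by rewrite /excess_distr; case: ifPn => // _; exact: distr_fun_le1. Qed.

Lemma excess_distr_lt0 (y : R) : y < 0 -> K y = 0.
Proof. by rewrite /excess_distr => ->. Qed.

Lemma excess_distr_int : (\int[mu]_(r in `[0%R, +oo[) (1 - K r)%:E < +oo)%E.
Proof.
have -> : (\int[mu]_(r in `[0%R, +oo[) (1 - K r)%:E =
    \int[mu]_(r in `[0%R, +oo[) (1 - F (x + r))%:E)%E.
  apply: eq_integral => r; rewrite inE/= in_itv/= andbT => r0.
  by rewrite /excess_distr ltNge r0.
rewrite -expectation_excess; apply: le_lt_trans X_int.
apply: expectation_le => //.
- by apply: measurable_maxr => //; exact: measurable_funB.
- by move=> w; rewrite le_max lexx orbT.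
- apply: aeW => w /=; rewrite ge_max X_ge0 andbT; have := x_gt0; lra.
Qed.

Lemma expectation_sample_excess (n : nat) : (0 < n)%N ->
  ('E_P[(fun w => Num.max (Z n w - x) 0)%R] = (integrated_tail K n%:R)%:E)%E.
Proof.
move=> n0.
transitivity ('E_P[(fun w => Num.max (@sample_max_RV _ _ _ P X n w - x) 0)%R])%E.
  by [].
rewrite expectation_excess -integrated_tailE//; last first.
- exact: excess_distr_int.
- exact: excess_distr_le1.
- exact: excess_distr_ge0.
- exact: excess_distr_nd.
apply: eq_integral => r; rewrite inE/= in_itv/= andbT => r0.
rewrite distr_fun_sample_max// powR_mulrn ?excess_distr_ge0//.
by rewrite /excess_distr ltNge r0.
Qed.

Lemma Lfun_sample_excess (n : nat) : (0 < n)%N ->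
  (fun w => Num.max (Z n w - x) 0) \in Lfun P 1.
Proof.
move=> n0; apply/Lfun1_integrable/integrableP; split.
  apply/measurable_EFinP; apply: measurable_maxr => //.
  by apply: measurable_funB => //; exact: measurable_sample_max.
under eq_integral => w _ do rewrite /= ger0_norm ?le_max ?lexx ?orbT//.
have := expectation_sample_excess n0; rewrite unlock => ->.
exact: ltry.
Qed.

Lemma expectation_rel_excess (n : nat) : (0 < n)%N ->
  ('E_P[rel_excess (fun i => X i : T -> R) n x] =
   (integrated_tail K n%:R / x)%:E)%E.
Proof.
move=> n0; rewrite (_ : rel_excess _ _ _ =
    x^-1 \o* (fun w => Num.max (Z n w - x) 0))//.
rewrite expectationZl ?Lfun_sample_excess// expectation_sample_excess//.
by rewrite -EFinM mulrC.
Qed.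

(** Pointwise [Num.max (Z n w) x = x + Num.max (Z n w - x) 0], so the gap is an affine
    function of the excess. *)
Lemma expectation_rel_gap (n : nat) (xs : R) : (0 < n)%N ->
  ('E_P[rel_gap (fun i => X i : T -> R) xs n x] =
   ((xs - x - integrated_tail K n%:R) / xs)%:E)%E.
Proof.
move=> n0; rewrite (_ : rel_gap _ _ _ _ = (cst ((xs - x) / xs)) \-
    (xs^-1 \o* (fun w => Num.max (Z n w - x) 0))); last first.
  apply/funext => w; rewrite /rel_gap /= -mulrBl; congr (_ / _).
  by rewrite maxEle [in RHS]maxEle; case: ifPn; case: ifPn => ? ?; lra.
rewrite expectationB ?Lfun_cst ?Lfun_scale ?Lfun_sample_excess//.
rewrite expectation_cst expectationZl ?Lfun_sample_excess//.
by rewrite expectation_sample_excess// -EFinM -EFinB; congr _%:E; ring.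
Qed.

End expected_excess.

(** * Regular variation of the expectations *)

Theorem corollary3p4 (R : realType) (d : measure_display)
    (T : measurableType d) (P : probability T R)
    (X : nat -> {RV P >-> R})
    (hiid : iid X)
    (hX0 : forall (i : nat) (w : T), 0 <= X i w)
    (F : R -> R) (hF : F = distr_fun (X 0%N))
    (xstar : \bar R) (hxstar : xstar = right_endpoint F)
    (hxstar0 : (0 < xstar)%E)
    (hEX : ('E_P[X 0%N] < +oo)%E)
    (xi : R) (hxi : xi < 1)
    (hMDA : in_MDA F (gev xi)) :
  (0 <= xi < 1 -> xstar = +oo%E ->
     forall x : R, 0 < x ->
       exists L : R -> R, slowly_varying L /\
         forall n : nat, (0 < n)%N ->
           'E_P[rel_excess (fun i : nat => X i : T -> R) n x]%E =
             (L n%:R * n%:R `^ xi)%:E)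
  /\
  (forall xs : R, xi <= 0 -> xstar = xs%:E ->
     forall x : R, 0 < x < xs ->
       exists L : R -> R, slowly_varying L /\
         forall n : nat, (0 < n)%N ->
           'E_P[rel_excess (fun i : nat => X i : T -> R) n x]%E =
             ((xs - x) / x - xs / x * (L n%:R * n%:R `^ xi))%:E /\
           'E_P[rel_gap (fun i : nat => X i : T -> R) xs n x]%E =
             (L n%:R * n%:R `^ xi)%:E).
Proof.
subst F xstar; set F := distr_fun (X 0%N).
have F_nd : {homo F : y z / y <= z} by exact: distr_fun_nd.
have F_ge0 y : 0 <= F y by exact: distr_fun_ge0.
have [A [B [A0 BA FA]]] := in_MDA_attracted F_ge0 hMDA.
have K_nd x : {homo excess_distr F x : y z / y <= z} by exact: excess_distr_nd.
have K_ge0 x y : 0 <= excess_distr F x y by exact: excess_distr_ge0.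
have K_le1 x y : excess_distr F x y <= 1 by exact: excess_distr_le1.
have K_lt0 x y : y < 0 -> excess_distr F x y = 0 by exact: excess_distr_lt0.
have H_meas x (x0 : 0 < x) : measurable_fun setT (integrated_tail (excess_distr F x)).
  apply: nondecreasing_measurable => //.
  exact: (integrated_tail_nd (K_nd x) (K_ge0 x) (K_le1 x) (excess_distr_int hX0 hEX x0)).
have K_int x (x0 : 0 < x) := excess_distr_int hX0 hEX x0.
have KA x : F x < 1 ->
    attracted xi (excess_distr F x) A (fun t => B t - x).
  by move=> Fx; exact: attracted_shift FA.
have powRNK (n : nat) : (0 < n)%N -> n%:R `^ (- xi) * n%:R `^ xi = 1 :> R.
  by move=> n0; rewrite powRN mulVf// gt_eqF//; apply: powR_gt0; rewrite ltr0n.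
split.
- move=> _ xsy x x0.
  have F_lt1 y : F y < 1 by apply: right_endpoint_lt1; rewrite // xsy ltry.
  have KAx := KA _ (F_lt1 x).
  have Hlim : integrated_tail (excess_distr F x) t @[t --> +oo] --> +oo.
    apply: cvg_integrated_tail_pinfty => //; first exact: K_int.
    by move=> m; rewrite /excess_distr; case: ifP.
  exists (fun t => x^-1 * integrated_tail (excess_distr F x) t * t `^ (- xi)).
  split=> [|n n0]; last first.
    by rewrite expectation_rel_excess//= -!mulrA powRNK// mulr1 mulrC.
  apply: slowly_varying_rescale; first by rewrite invr_gt0.
  + exact: H_meas.
  + by move/cvgryPgt : Hlim => /(_ 0).
  + move=> c c0; exact: (integrated_tail_regular_pinfty (K_nd x) (K_ge0 x) (K_le1 x)
      (K_int _ x0) (K_lt0 x) A0 (BA x) KAx hxi c0 Hlim).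
- move=> xs xi0 xsE x /andP[x0 xxs].
  have F_lt1 y : y < xs -> F y < 1.
    by move=> yx; apply: right_endpoint_lt1; rewrite // xsE lte_fin.
  have F_eq1 y : xs < y -> F y = 1.
    move=> yx; apply/eqP; rewrite eq_le distr_fun_le1/=.
    apply: right_endpoint_ge1; last by rewrite xsE lte_fin.
    by rewrite ltW// (lt_trans _ yx)// (lt_trans x0).
  have KAx := KA _ (F_lt1 _ xxs).
  have Hlim : integrated_tail (excess_distr F x) t @[t --> +oo] --> xs - x.
    apply: cvg_integrated_tail => //; first exact: K_int.
    - by rewrite subr_gt0.
    - by move=> m mx; rewrite /excess_distr; case: ifP => // _; rewrite F_lt1//; lra.
    - by move=> m mx; rewrite /excess_distr ifF ?F_eq1//; lra.
  exists (fun t => xs^-1 * (xs - x - integrated_tail (excess_distr F x) t) * t `^ (- xi)).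
  have xs0 : 0 < xs by exact: lt_trans xxs.
  split=> [|n n0]; last first.
    rewrite expectation_rel_excess// expectation_rel_gap//= -!mulrA powRNK// mulr1.
    by split; congr _%:E; [field; rewrite !gt_eqF|rewrite mulrC].
  apply: slowly_varying_rescale; first by rewrite invr_gt0.
  + by apply: measurable_funB => //; exact: H_meas.
  + exact: (near_integrated_tail_lt_lim (K_nd x) (K_ge0 x) (K_le1 x)
      (K_int _ x0) (K_lt0 x) A0 (BA x) KAx hxi Hlim).
  + move=> c c0; exact: (integrated_tail_regular_lim (K_nd x) (K_ge0 x) (K_le1 x)
      (K_int _ x0) (K_lt0 x) A0 (BA x) KAx hxi c0 Hlim).
Qed.
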